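(* Let $u=(u_1,u_2,u_3)$ and $p$ be the functions defined by $$u_1(x)= 2\,\frac{c|x|^2-2x_1|x|+cx_1^2}{|x|(c|x|-x_1)^2},\quad u_2(x)= 2\,\frac{x_2(cx_1-|x|)}{|x|(c|x|-x_1)^2},\quad u_3(x)= 2\,\frac{x_3(cx_1-|x|)}{|x|(c|x|-x_1)^2},\quad p(x)= 4\,\frac{cx_1-|x|}{|x|(c|x|-x_1)^2},$$ where $c$ is an arbitrary real constant such that $|c|>1$. For every test function $\varphi\in C_c^\infty(\mathbb{R}^3)$ the following equalities hold true: $$\int_{\mathbb{R}^3} u\cdot\nabla\varphi\,dx=0$$ and $$\int_{\mathbb{R}^3}\left(\nabla u_k\cdot\nabla\varphi-u_k\,u\cdot\nabla\varphi-p\,\frac{\partial\varphi}{\partial x_k}\right)dx=\begin{cases} -b(c)\varphi(0) & \text{if } k=1,\\ 0 & \text{if } k=2,3,\end{cases}$$ where $$b(c)=4\pi\left(4c+2c^2\log\frac{c-1}{c+1}+\frac{16}{3}\,\frac{c}{c^2-1}\right).$$ In particular, the function $b=b(c)$ is decreasing on $(-\infty,-1)$ and on $(1,+\infty)$. Moreover, $\lim_{c\searrow 1}b(c)=\infty$, $\lim_{c\nearrow -1}b(c)=-\infty$ and $\lim_{|c|\to\infty}b(c)=0$.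
   Context: Here $x=(x_1,x_2,x_3)\in\mathbb{R}^3$ and $|x|=\sqrt{x_1^2+x_2^2+x_3^2}$. The functions $u$ and $p$ are defined on $\mathbb{R}^3\setminus\{0\}$; each $u_k$ is homogeneous of degree $-1$ and belongs to $W^{1,q}_{loc}(\mathbb{R}^3)$ for $1\le q<3/2$, so $\nabla u_k$ is its gradient (pointwise away from the origin, equivalently weak). $\log$ is the natural logarithm.
   Formalization: For k = 1 the right-hand side is +b(c)φ(0) instead of the printed −b(c)φ(0): with the given u, p and b the printed sign is false whenever φ(0) ≠ 0 (as c → ∞, u is the Stokeslet of force 16π/c and b(c) ~ 16π/c > 0). *)

(* Defs.v *)
From HB Require Import structures.
From mathcomp Require Import all_boot all_order all_algebra.
From mathcomp Require Import all_classical all_reals all_analysis.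

Set Implicit Arguments.
Unset Strict Implicit.
Unset Printing Implicit Defensive.

Import Order.TTheory GRing.Theory Num.Theory.
Import numFieldNormedType.Exports.

Local Open Scope classical_set_scope.
Local Open Scope ring_scope.

(* Coordinates are numbered from 0: the k-th coordinate of the text is indexed
   by the ordinal k - 1. *)

Definition coord (R : realType) (k : 'I_3) (x : R * R * R) : R :=
  tnth [tuple x.1.1; x.1.2; x.2] k.

Definition basis3 (R : realType) (k : 'I_3) : R * R * R :=
  ((k == 0%N :> nat)%:R, (k == 1%N :> nat)%:R, (k == 2%N :> nat)%:R).

(* The library norm on R * R * R is the sup norm; it gives the usual topology,
   but |x| in the formulas below is the Euclidean norm. *)
Definition enorm (R : realType) (x : R * R * R) : R :=
  Num.sqrt (\sum_(k < 3) coord k x ^+ 2).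

Definition lebesgue3 (R : realType) :
    {measure set (measurableTypeR R * measurableTypeR R * measurableTypeR R)
       -> \bar R} :=
  ((@lebesgue_measure R \x @lebesgue_measure R) \x @lebesgue_measure R)%E.

Definition partial (R : realType) (k : 'I_3) (f : R * R * R -> R) :
    R * R * R -> R :=
  fun x => 'D_(@basis3 R k) f x.

Definition iter_partial (R : realType) (s : seq 'I_3) (f : R * R * R -> R) :
    R * R * R -> R :=
  foldr (@partial R) f s.

Definition smooth (R : realType) (f : R * R * R -> R) : Prop :=
  forall s : seq 'I_3, continuous (iter_partial s f) /\
    forall (k : 'I_3) (x : R * R * R),
      derivable (iter_partial s f) x (@basis3 R k).

Definition test_function (R : realType) (f : R * R * R -> R) : Prop :=
  smooth f /\ compact (closure [set x | f x != 0]).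

Definition grad_dot (R : realType) (f g : R * R * R -> R) (x : R * R * R) : R :=
  \sum_(j < 3) partial j f x * partial j g x.

Definition field_dot_grad (R : realType) (v : 'I_3 -> R * R * R -> R)
    (f : R * R * R -> R) (x : R * R * R) : R :=
  \sum_(j < 3) v j x * partial j f x.

(* Division by 0 is 0, so the fields below take a junk value at the origin and
   [partial] of them is meaningless there; the origin is a null set. *)

Definition landau_u1 (R : realType) (c : R) (x : R * R * R) : R :=
  let x1 := x.1.1 in let r := enorm x in
  2 * ((c * r ^+ 2 - 2 * x1 * r + c * x1 ^+ 2) / (r * (c * r - x1) ^+ 2)).

Definition landau_u2 (R : realType) (c : R) (x : R * R * R) : R :=
  let x1 := x.1.1 in let x2 := x.1.2 in let r := enorm x in
  2 * ((x2 * (c * x1 - r)) / (r * (c * r - x1) ^+ 2)).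

Definition landau_u3 (R : realType) (c : R) (x : R * R * R) : R :=
  let x1 := x.1.1 in let x3 := x.2 in let r := enorm x in
  2 * ((x3 * (c * x1 - r)) / (r * (c * r - x1) ^+ 2)).

Definition landau_u (R : realType) (c : R) (k : 'I_3) : R * R * R -> R :=
  tnth [tuple landau_u1 c; landau_u2 c; landau_u3 c] k.

Definition landau_p (R : realType) (c : R) (x : R * R * R) : R :=
  let x1 := x.1.1 in let r := enorm x in
  4 * ((c * x1 - r) / (r * (c * r - x1) ^+ 2)).

(* The point force on the first axis. Its sign in the momentum identity is
   + b(c) phi(0): testing against a radial phi, the left-hand side is phi(0)
   times the integral of u_1 + u_1 (u . x) + p x_1 over the unit sphere, and
   that integral is landau_b c (16 pi / c + o(1/c) as c grows). The source
   text prints - b(c) phi(0), which is incompatible with these u, p and b. *)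
Definition landau_b (R : realType) (c : R) : R :=
  4 * pi * (4 * c + 2 * c ^+ 2 * ln ((c - 1) / (c + 1))
            + 16 / 3 * (c / (c ^+ 2 - 1))).

Definition abs_pinfty (R : realType) : set_system R :=
  filter_from [set: R] (fun M => [set c | M < `|c|]).

Global Instance abs_pinfty_filter (R : realType) : ProperFilter (@abs_pinfty R).
Proof.
apply: filter_from_proper; last first.
  move=> M _; exists (`|M| + 1) => /=.
  rewrite ger0_norm ?addr_ge0//.
  by rewrite (le_lt_trans (ler_norm M))// ltrDl.
apply: filter_from_filter; first by exists 0.
move=> M N _ _; exists (Num.max M N) => // c /=.
by rewrite gt_max => /andP[].
Qed.

(* Main.v *)
(* Away from the origin every field of the momentum identity is a power of |x|
   times a polynomial in the direction cosines x_j/|x| and e = |x|/(c|x| - x_1):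
   u = angular_u/|x|, p = angular_p/|x|^2, and the momentum flux
   grad u_k - u_k u - p e_k is homogeneous of degree -2 and divergence free. Its
   radial component g_k x/|x|^3 is divergence free by itself, and its tangential
   component is the curl of a field A_k of degree -1. Fields of degree -1 can be
   integrated by parts against test functions, since almost every line parallel to
   an axis misses the origin; so div u = 0 gives the first identity, and
   int curl A_k . grad phi = 0 because second derivatives of phi commute. In the
   coordinates x = y (a, 1, w) the radial term is integrated along the rays first,
   which leaves - phi(0) times the flux of g_k x/|x|^3 through the unit sphere. For
   k = 2, 3 this flux vanishes because g_k changes sign under a reflection; for
   k = 1 it is - b(c), the integral of an explicit rational function of x_1/|x|.
   Finally b is odd, b' < 0 follows from ln ((c-1)/(c+1)) < - 2/c, and one more term
   of the expansion of the logarithm squeezes b between 16 pi c/(c^2 - 1) and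
   (64/3) pi c/(c^2 - 1) for c > 1, which gives the limits. *)
From HB Require Import structures.
From mathcomp Require Import all_boot all_order all_algebra.
From mathcomp Require Import all_classical all_reals all_analysis.
From mathcomp Require Import ring lra measurable_realfun.
Require Import Defs.

Set Implicit Arguments.
Unset Strict Implicit.
Unset Printing Implicit Defensive.

Import Order.TTheory GRing.Theory Num.Theory.
Import numFieldNormedType.Exports.

Local Open Scope classical_set_scope.
Local Open Scope ring_scope.

(** * Integrals over the line *)

Section integral_value.
Local Open Scope ereal_scope.
Context d (T : measurableType d) (R : realType).
Variable mu : {measure set T -> \bar R}.
Implicit Types (f g : T -> R) (v w k : R).

(** Integrability travels with the value, since the linearity of the Lebesgue integral needs
    both. *)
Definition has_integral f v :=
  mu.-integrable [set: T] (EFin \o f) /\ \int[mu]_x (f x)%:E = v%:E.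

Lemma has_integralD f g v w : has_integral f v -> has_integral g w ->
  has_integral (f \+ g)%R (v + w).
Proof.
move=> [fi fv] [gi gw]; split.
  by rewrite (_ : _ \o _ = (EFin \o f) \+ (EFin \o g))//; exact: integrableD.
by rewrite EFinD -fv -gw -integralD.
Qed.

Lemma has_integralZ f v k : has_integral f v ->
  has_integral (fun x => k * f x)%R (k * v).
Proof.
move=> [fi fv]; split.
  exact: (integrableZl measurableT k fi).
by rewrite EFinM -fv -integralZl.
Qed.

Lemma has_integral_eq f g v : f =1 g -> has_integral f v -> has_integral g v.
Proof. by move=> /funext ->. Qed.

Lemma has_integral_restrict f v (D : set T) : measurable D ->
  mu.-integrable D (EFin \o f) -> \int[mu]_(x in D) (f x)%:E = v%:E ->
  has_integral (f \_ D)%R v.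
Proof.
move=> mD fi fv; split.
  rewrite -restrict_EFin. apply: (integrable_mkcond _ mD).1 => //.
by rewrite -fv [RHS]integral_mkcond -[in RHS]/(EFin \o f) restrict_EFin.
Qed.

End integral_value.

Section line.
Context {R : realType}.
Notation mu := (@lebesgue_measure R).
Implicit Types (f F G : R -> R).

Lemma is_derive_continuous F (x a : R) : is_derive x 1 F a -> {for x, continuous F}.
Proof.
by move=> [dF _]; apply: differentiable_continuous; exact/derivable1_diffP.
Qed.

Lemma has_integral_segment f F (a b : R) : a < b -> continuous f ->
  (forall x : R, is_derive x 1 F (f x)) ->
  has_integral mu (f \_ `[a, b]) (F b - F a).
Proof.
move=> ab cf dF; apply: has_integral_restrict => //.
  apply: continuous_compact_integrable; first exact: segment_compact.
  exact: continuous_subspaceT.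
rewrite EFinB (@continuous_FTC2 _ f F)//.
- exact: continuous_subspaceT.
- split.
  + by move=> x _; apply: ex_derive.
  + by apply: cvg_at_right_filter; exact: (is_derive_continuous (dF a)).
  + by apply: cvg_at_left_filter; exact: (is_derive_continuous (dF b)).
- by move=> x _; rewrite derive1E; exact: derive_val.
Qed.

Lemma has_integral_segment_oc f F (a b : R) : a < b -> continuous f ->
  (forall x : R, is_derive x 1 F (f x)) ->
  has_integral mu (f \_ `]a, b]) (F b - F a).
Proof.
move=> ab cf dF.
have [_ FF] := has_integral_segment ab cf dF.
have ccI : mu.-integrable `[a, b] (EFin \o f).
  apply: continuous_compact_integrable; first exact: segment_compact.
  exact: continuous_subspaceT.
have mf : measurable_fun `]a, b] (EFin \o f).
  by apply/measurable_EFinP/measurable_funTS; exact: continuous_measurable_fun.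
apply: has_integral_restrict => //.
  by apply: integrableS ccI => //; exact: subset_itv_oc_cc.
rewrite (integral_itv_obnd_cbnd mf) -FF [LHS]integral_mkcond.
by rewrite -[in LHS]/(EFin \o f) restrict_EFin.
Qed.

(** A step function against the derivative of a compactly supported [F] leaves the jump at 0 times
    [F 0]. On a line through the origin, the step is an angular factor taking one constant value on
    each half-line. *)
Lemma has_integral_two_sided (F f : R -> R) (M k1 k2 : R) : 0 < M ->
  continuous f -> (forall x : R, is_derive x 1 F (f x)) ->
  (forall x, M <= `|x| -> F x = 0) -> (forall x, M <= `|x| -> f x = 0) ->
  has_integral mu (fun x => (if 0 < x then k1 else k2) * f x)
    ((k2 - k1) * F 0).
Proof.
move=> M0 cf dF F0 f0.
have h1 := has_integralZ k1 (has_integral_segment_oc M0 cf dF).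
have M0' : - M < 0 by rewrite oppr_lt0.
have h2 := has_integralZ k2 (has_integral_segment M0' cf dF).
have := has_integralD h1 h2.
rewrite (F0 M) ?(F0 (- M)) ?normrN ?ler_norm// sub0r subr0.
rewrite (_ : _ + _ = (k2 - k1) * F 0); last by ring.
apply: has_integral_eq => x /=.
rewrite !patchE !mem_setE !in_itv/=.
have [Mx|xM] := leP M `|x|.
  by rewrite f0//; do 2 case: ifP => _; rewrite ?mulr0 ?addr0.
move: xM; rewrite ltr_norml => /andP[Mx xM].
by case: (ltP 0 x) => x0; rewrite (ltW Mx) ?(ltW xM) ?mulr0 ?addr0 ?add0r.
Qed.

Lemma has_integral_compact_derive (F f : R -> R) (M : R) : 0 < M ->
  continuous f -> (forall x : R, is_derive x 1 F (f x)) ->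
  (forall x, M <= `|x| -> F x = 0) -> (forall x, M <= `|x| -> f x = 0) ->
  has_integral mu f 0.
Proof.
move=> M0 cf dF F0 f0.
have := has_integral_two_sided 1 1 M0 cf dF F0 f0.
rewrite subrr mul0r; apply: has_integral_eq => x.
by rewrite if_same mul1r.
Qed.

(** Nonnegativity lets the fundamental theorem run up to infinity before integrability is known; the
    finite value then yields integrability. *)
Lemma has_integral_even (f F : R -> R) (l : R) : (forall x, 0 <= f x) ->
  continuous f -> (forall x, f (- x) = f x) ->
  (forall x : R, is_derive x 1 F (f x)) -> F x @[x --> +oo] --> l ->
  has_integral mu f (2 * (l - F 0)).
Proof.
move=> f0 cf ef dF Fl.
have ie : (\int[mu]_x (f x)%:E = (2 * (l - F 0))%:E)%E.
  rewrite (ge0_symfun_integralT f0 cf) -?set_itvcy; last by move=> x; rewrite /= ef.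
  rewrite (@ge0_continuous_FTC2y _ f F 0 l)//.
  - by apply: continuous_subspaceT.
  - by apply: cvg_at_right_filter; exact: (is_derive_continuous (dF 0)).
  - by move=> x _; rewrite derive1E; exact: derive_val.
split => //; apply/integrableP; split.
  by apply/measurable_EFinP; exact: continuous_measurable_fun.
under eq_integral => x _ do rewrite /= ger0_norm//.
by rewrite ie ltry.
Qed.

End line.

(** * Projective coordinates in space *)

Section scaling.
Context {R : realType}.
Local Open Scope ereal_scope.
Notation mu := (@lebesgue_measure R).

(** By uniqueness of Lebesgue measure it is enough to compare both sides on the intervals ]a, b]. *)
Lemma lebesgue_measure_scale (y : R) (A : set R) : (0 < y)%R -> measurable A ->
  y%:E * pushforward mu ( *%R y : _ -> measurableTypeR R) A = mu A.
Proof.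
move=> y0 mA; apply/esym.
unshelve eapply (@lebesgue_measure_unique R (mscale (NngNum (ltW y0)) _)) => //.
move=> _ [[a b]] _ <-.
have pre : *%R y @^-1` `]a, b]%classic = `](y^-1 * a)%R, (y^-1 * b)%R]%classic.
  apply/seteqP; split => x /=; rewrite !in_itv/=.
    by rewrite ltr_pdivrMl// ler_pdivlMl.
  by rewrite ltr_pdivrMl// ler_pdivlMl.
change (mu `]a, b] = y%:E * mu ( *%R y @^-1` `]a, b]%classic)).
rewrite pre !lebesgue_measure_itv/= !lte_fin ltr_pM2l ?invr_gt0//.
case: ifP => _; last by rewrite mule0.
by rewrite -!EFinB -EFinM -mulrBr mulVKf// gt_eqF.
Qed.

Lemma ge0_integral_opp (f : R -> \bar R) : measurable_fun setT f ->
  (forall x, 0 <= f x) -> \int[mu]_x f x = \int[mu]_x f (- x)%R.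
Proof.
move=> mf f0.
have mN : measurable_fun setT (-%R : measurableTypeR R -> measurableTypeR R).
  exact: oppr_measurable.
rewrite -[RHS](ge0_integral_pushforward mN mu measurableT mf)//.
by apply: eq_measure_integral => A mA _; exact/esym/lebesgue_measureN.
Qed.

Lemma ge0_integral_scale (y : R) (f : R -> \bar R) : y != 0%R ->
  measurable_fun setT f -> (forall x, 0 <= f x) ->
  \int[mu]_x f x = `|y|%:E * \int[mu]_x f (y * x)%R.
Proof.
(* A negative factor is a positive one composed with the reflection, which preserves the measure. *)
wlog y0 : y f / (0 < y)%R => [wl yneq0 mf f0|_ mf f0].
  have [/wl|] := ltP 0%R y; first exact.
  rewrite le_eqVlt (negPf yneq0)/= => y0.
  rewrite ge0_integral_opp// (wl (- y)%R (fun x => f (- x)%R))//.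
  - by rewrite normrN; under [in RHS]eq_integral do rewrite -[(y * _)%R]opprK -mulNr.
  - by rewrite oppr_gt0.
  - by rewrite oppr_eq0.
  - by apply: measurableT_comp => //; exact: oppr_measurable.
have my : measurable_fun setT ( *%R y : measurableTypeR R -> measurableTypeR R).
  exact: mulrl_measurable.
rewrite -[in RHS](ge0_integral_pushforward my mu measurableT mf)//.
rewrite gtr0_norm// -(ge0_integral_mscale _ _ (NngNum (ltW y0)))//.
by apply: eq_measure_integral => A mA _; exact/esym/lebesgue_measure_scale.
Qed.

(* Product measures are sigma-finite in the library, but the canonical instance
   inferred for them is the one of subprobabilities. *)
Lemma sigma_finite_lebesgue2 : sigma_finite setT (mu \x mu).
Proof.
have /sigma_finiteP[F [TF ndF Foo]] := sigma_finiteT mu.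
exists (fun n => F n `*` F n) => [|n].
  rewrite -setXTT TF predeqE => -[x y]; split.
    move=> [/= [n _ Fnx] [k _ Gky]]; exists (maxn n k) => //; split.
    - by move: x Fnx; exact/subsetPset/ndF/leq_maxl.
    - by move: y Gky; exact/subsetPset/ndF/leq_maxr.
  by move=> [n _ []/= ? ?]; split; exists n.
have [mFn Fnoo] := Foo n.
split; first exact: measurableX.
by rewrite product_measure1E// lte_mul_pinfty// ge0_fin_numE.
Qed.

Definition lebesgue2 : {sigma_finite_measure set
    (measurableTypeR R * measurableTypeR R)%type -> \bar R} :=
  HB.pack (mu \x mu) (Measure_isSigmaFinite.Build _ _ _ (mu \x mu)
    sigma_finite_lebesgue2).

(* Projective coordinates along the second axis: the point on the ray through
   (a, 1, w) whose second coordinate is y. *)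
Definition ray_point (z : R * R * R) : R * R * R :=
  ((z.1.1 * z.1.2, z.1.1), z.1.1 * z.2)%R.

Lemma measurable_ray_point :
  measurable_fun [set: measurableTypeR R * measurableTypeR R * measurableTypeR R]
   (ray_point : _ -> measurableTypeR R * measurableTypeR R * measurableTypeR R).
Proof.
have m1 : measurable_fun [set: measurableTypeR R * measurableTypeR R * measurableTypeR R]
   (fun z => z.1.1) by apply: measurableT_comp.
have m2 : measurable_fun [set: measurableTypeR R * measurableTypeR R * measurableTypeR R]
   (fun z => z.1.2) by apply: measurableT_comp.
apply: measurable_fun_pair; first apply: measurable_fun_pair => //.
  exact: measurable_funM.
exact: measurable_funM.
Qed.

(** The factor y^2 is the Jacobian of (y, a, w) -> (y a, y, y w). No change of variables in space is
    needed: for fixed nonzero y the first and third coordinates are each rescaled by y, and the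
    plane y = 0 is null. *)
Lemma ge0_integral_ray_point (f : R * R * R -> \bar R) :
  measurable_fun [set: measurableTypeR R * measurableTypeR R * measurableTypeR R] f ->
  (forall x, 0 <= f x) ->
  \int[@lebesgue3 R]_x f x =
  \int[@lebesgue3 R]_z ((z.1.1 ^+ 2)%:E * f (ray_point z)).
Proof.
move=> mf f0.
set g := fun z : R * R * R => (z.1.1 ^+ 2)%:E * f (ray_point z).
have mg : measurable_fun [set: measurableTypeR R * measurableTypeR R * measurableTypeR R] g.
  apply: emeasurable_funM.
    apply/measurable_EFinP; apply: measurable_funX.
    by apply: measurableT_comp.
  by apply: measurableT_comp => //; exact: measurable_ray_point.
have g0 z : 0 <= g z by apply: mule_ge0 => //; rewrite lee_fin sqr_ge0.
have mF := measurable_fun_fubini_tonelli_F (m2 := mu) f mf f0.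
have mG := measurable_fun_fubini_tonelli_F (m2 := mu) g mg g0.
have F0 p : 0 <= fubini_F mu f p by apply: integral_ge0 => *; exact: f0.
have G0 p : 0 <= fubini_F mu g p by apply: integral_ge0 => *; exact: g0.
(* Tonelli on both sides so that y is integrated last: it is the second coordinate of the point on
   the left, and the first parameter on the right. *)
transitivity (\int[mu]_y fubini_G mu (fubini_F mu f) y).
  rewrite -(fubini_tonelli2 (m1 := mu) (m2 := mu) _ mF F0).
  exact: (fubini_tonelli1 (m1 := lebesgue2) (m2 := mu) f mf f0).
transitivity (\int[mu]_y fubini_F mu (fubini_F mu g) y); last first.
  rewrite -(fubini_tonelli1 (m1 := mu) (m2 := mu) _ mG G0).
  exact/esym/(fubini_tonelli1 (m1 := lebesgue2) (m2 := mu) g mg g0).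
apply: ge0_ae_eq_integral => //.
- exact: measurable_fun_fubini_tonelli_G.
- exact: measurable_fun_fubini_tonelli_F.
- by move=> y _; apply: integral_ge0 => *; exact: F0.
- by move=> y _; apply: integral_ge0 => *; exact: G0.
exists [set 0%R]; split => //; first exact: lebesgue_measure_set1.
move=> y /= yN; apply: contrapT => /eqP y0; apply: yN => _.
rewrite /fubini_G (ge0_integral_scale y0)//; last first.
  exact: (measurable_fun_pair1 y mF).
rewrite [RHS]/fubini_F -ge0_integralZl//; last first.
  exact: (measurableT_comp mF (measurable_fun_pair (mulrl_measurable y) _)).
apply: eq_integral => a _.
rewrite /fubini_F (ge0_integral_scale y0)//; last first.
  exact: (measurable_fun_pair2 ((y * a)%R, y) mf).
rewrite muleA -EFinM -expr2 real_normK ?num_real//.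
rewrite -(ge0_integralZl mu measurableT)//= ?lee_fin ?sqr_ge0//.
exact: (measurableT_comp mf (measurable_fun_pair _ (mulrl_measurable y))).
Qed.

End scaling.

(** * Change of variables and iterated integrals for signed functions *)

Section fubini3.
Context {R : realType}.
Notation mu := (@lebesgue_measure R).
Notation R3 := (measurableTypeR R * measurableTypeR R * measurableTypeR R)%type.

Lemma has_integral_ray_point (f : R * R * R -> R) (v : R) :
  (@lebesgue3 R).-integrable [set: R * R * R] (EFin \o f) ->
  has_integral (@lebesgue3 R) (fun z => z.1.1 ^+ 2 * f (ray_point z)) v ->
  has_integral (@lebesgue3 R) f v.
Proof.
move=> fi [_ gv]; split=> //; rewrite -gv.
have mf : measurable_fun [set: R3] (EFin \o f) := measurable_int _ fi.
pose g (z : R * R * R) := z.1.1 ^+ 2 * f (ray_point z).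
(* The Jacobian is nonnegative, so it commutes with positive and negative parts, and the nonnegative
   case applies to each. *)
have pE z : ((EFin \o g)^\+ z = (z.1.1 ^+ 2)%:E * (EFin \o f)^\+ (ray_point z))%E.
  have := ge0_funeposM (fun _ : unit => (f (ray_point z))%:E) (sqr_ge0 z.1.1).
  by move=> /(congr1 (fun F : unit -> \bar R => F tt)); rewrite !funeposE.
have nE z : ((EFin \o g)^\- z = (z.1.1 ^+ 2)%:E * (EFin \o f)^\- (ray_point z))%E.
  have := ge0_funenegM (fun _ : unit => (f (ray_point z))%:E) (sqr_ge0 z.1.1).
  by move=> /(congr1 (fun F : unit -> \bar R => F tt)); rewrite !funenegE.
transitivity (\int[@lebesgue3 R]_x (EFin \o g) x)%E; last by [].
rewrite integralE [RHS]integralE; apply: (f_equal2 (fun a b => a - b)%E).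
  rewrite ge0_integral_ray_point//; last exact: measurable_funepos.
  by apply: eq_integral => z _; rewrite pE.
rewrite ge0_integral_ray_point//; last exact: measurable_funeneg.
by apply: eq_integral => z _; rewrite nE.
Qed.

Lemma integrable_ray_point (f : R * R * R -> R) :
  (@lebesgue3 R).-integrable [set: R * R * R] (EFin \o f) ->
  (@lebesgue3 R).-integrable [set: R * R * R]
    (EFin \o (fun z => z.1.1 ^+ 2 * f (ray_point z))).
Proof.
move=> fi.
have mf : measurable_fun [set: R3] (EFin \o f) := measurable_int _ fi.
have mz : measurable_fun [set: R3] (fun z => z.1.1 ^+ 2).
  by apply: measurable_funX; apply: measurableT_comp.
apply/integrableP; split.
  apply/measurable_EFinP; apply: measurable_funM => //.
  by apply: measurableT_comp; [exact/measurable_EFinP|exact: measurable_ray_point].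
move/integrableP : fi => [_]; apply: le_lt_trans.
rewrite [leRHS]ge0_integral_ray_point//; last exact: measurableT_comp.
rewrite le_eqVlt; apply/orP; left; apply/eqP.
by apply: eq_integral => z _; rewrite /= normrM EFinM ger0_norm ?sqr_ge0.
Qed.

(** The null set w = 0 is absorbed here, so the inner integrals need only be computed where the
    points ((y, a), w) avoid the origin. *)
Lemma integral_iterated (h : R * R * R -> R) (l1 : R -> R -> R) (l2 : R -> R) :
  (@lebesgue3 R).-integrable [set: R * R * R] (EFin \o h) ->
  measurable_fun setT l2 ->
  (forall a w : R, w != 0%R -> \int[mu]_y (h ((y, a), w))%:E = (l1 a w)%:E)%E ->
  (forall w : R, w != 0%R -> \int[mu]_a (l1 a w)%:E = (l2 w)%:E)%E ->
  (\int[@lebesgue3 R]_x (h x)%:E = \int[mu]_w (l2 w)%:E)%E.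
Proof.
move=> hi ml2 hl1 hl2.
rewrite -[LHS](integral21_prod_meas1 (m1 := lebesgue2) (m2 := mu) (f := EFin \o h) hi).
apply: ae_eq_integral => //.
- exact: (measurable_fubini_G (m1 := lebesgue2) (m2 := mu) (f := EFin \o h) hi).
- exact/measurable_EFinP.
have := ae_integrable2 (m1 := lebesgue2) (m2 := mu) (f := EFin \o h) hi.
have n0 : \forall w \ae mu, w != 0 :> R.
  exists [set 0]; split => //; first exact: lebesgue_measure_set1.
  by move=> w /= /negP; rewrite negbK => /eqP.
move=> Hi; near=> w => _.
have w0 : w != 0 by near: w.
rewrite -hl2//.
rewrite [LHS](_ : _ = \int[mu \x mu]_p (h (p, w))%:E)%E//.
rewrite -(integral21_prod_meas1 (m1 := mu) (m2 := mu) (f := fun p => (h (p, w))%:E)); last first.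
  by near: w.
by apply: eq_integral => a _; rewrite /fubini_G hl1.
Unshelve. all: by end_near. Qed.

End fubini3.

(** * Integration along lines parallel to an axis *)

Section lines.
Context {R : realType}.
Notation mu := (@lebesgue_measure R).
Notation R3 := (measurableTypeR R * measurableTypeR R * measurableTypeR R)%type.

Lemma line0E (x y z t : R) : ((x, y), z) + t *: basis3 R 0 = ((x + t, y), z).
Proof. by transitivity (((x + t * 1, y + t * 0), z + t * 0)); [|rewrite !mulr0 mulr1 !addr0]. Qed.

Lemma line1E (x y z t : R) : ((x, y), z) + t *: basis3 R 1 = ((x, y + t), z).
Proof. by transitivity (((x + t * 0, y + t * 1), z + t * 0)); [|rewrite !mulr0 mulr1 !addr0]. Qed.

Lemma line2E (x y z t : R) : ((x, y), z) + t *: basis3 R 2 = ((x, y), z + t).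
Proof. by transitivity (((x + t * 0, y + t * 0), z + t * 1)); [|rewrite !mulr0 mulr1 !addr0]. Qed.

(** Fubini with the i-th variable innermost: the lines through the origin form a null family. For
    the first two directions it suffices to discard the plane where the third coordinate is 0. *)
Lemma integral_lines_eq0 (i : 'I_3) (h : R * R * R -> R) :
  (@lebesgue3 R).-integrable [set: R * R * R] (EFin \o h) ->
  (forall x : R * R * R, (forall t : R, x + t *: basis3 R i != 0)%R ->
    \int[mu]_t (h (x + t *: basis3 R i)%R)%:E = 0)%E ->
  (\int[@lebesgue3 R]_x (h x)%:E = 0)%E.
Proof.
move=> hi hl.
have a2 := ae_integrable2 (m1 := lebesgue2) (m2 := mu) (f := EFin \o h) hi.
have n0 : \forall w \ae mu, w != 0 :> R.
  exists [set 0]; split => //; first exact: lebesgue_measure_set1.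
  by move=> w /= /negP; rewrite negbK => /eqP.
have [i0|i1|i2] : [\/ i = 0, i = 1 | i = 2].
  by case: i {hl} => [[|[|[|//]]]] ?; [apply: Or31|apply: Or32|apply: Or33];
    apply: val_inj.
- rewrite (@integral_iterated _ h (fun _ _ => 0) (fun _ => 0))//.
  + by rewrite integral0.
  + move=> y z z0; apply: eq_trans (hl ((0, y), z) _); rewrite i0.
      by apply: eq_integral => t _; rewrite line0E add0r.
    by move=> t; rewrite line0E; apply: contra z0 => /eqP[_ _ ->].
  + by move=> z z0; rewrite integral0.
- rewrite -[LHS](integral21_prod_meas1 (m1 := lebesgue2) (m2 := mu) (f := EFin \o h) hi).
  rewrite (ae_eq_integral (cst 0%E))// ?integral0//.
    exact: (measurable_fubini_G (m1 := lebesgue2) (m2 := mu) (f := EFin \o h) hi).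
  near=> z => _.
  have z0 : z != 0 by near: z.
  rewrite [LHS](_ : _ = \int[mu \x mu]_p (h (p, z))%:E)%E//.
  rewrite -(integral12_prod_meas1 (m1 := mu) (m2 := mu) (f := fun p => (h (p, z))%:E)); last first.
    by near: z.
  rewrite integral0_eq// => x _; apply: eq_trans (hl ((x, 0), z) _); rewrite i1.
    by apply: eq_integral => t _; rewrite line1E add0r.
  by move=> t; rewrite line1E; apply: contra z0 => /eqP[_ _ ->].
(* Lines along the third axis all meet the plane where the third coordinate is 0, so those with
   first coordinate 0 are discarded instead. *)
- rewrite -[LHS](integral12_prod_meas1 (m1 := lebesgue2) (m2 := mu) (f := EFin \o h) hi).
  rewrite (ae_eq_integral (cst 0%E))// ?integral0//.
    exact: (measurable_fubini_F (m1 := lebesgue2) (m2 := mu) (f := EFin \o h) hi).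
  exists ([set 0] `*` setT); split.
  + by apply: measurableX => //; exact: measurable_set1.
  + transitivity (mu [set 0%R] * mu setT)%E; first exact: product_measure1E.
    by rewrite lebesgue_measure_set1 mul0e.
  + move=> [x y] /= hN; split => //; apply: contrapT => /eqP x0; apply: hN => _.
    apply: eq_trans (hl ((x, y), 0) _); rewrite i2.
      by apply: eq_integral => t _; rewrite line2E add0r.
    by move=> t; rewrite line2E; apply: contra x0 => /eqP[->].
Unshelve. all: by end_near. Qed.

End lines.

(** * Measurability *)

Lemma continuous_pair (T U V : topologicalType) (f : T -> U) (g : T -> V) (t : T) :
  {for t, continuous f} -> {for t, continuous g} ->
  {for t, continuous (fun t => (f t, g t))}.
Proof.
by move=> cf cg; exact: (@cvg_pair _ _ _ (nbhs t) (nbhs (f t)) (nbhs (g t))).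
Qed.

Section measurability.
Context {R : realType}.
Notation R3 := (measurableTypeR R * measurableTypeR R * measurableTypeR R)%type.

Lemma measurable_inv : measurable_fun [set: R] (@GRing.inv R).
Proof.
(* This reduces the inverse to a real power of a nonnegative number; both sides are 0 at 0. *)
have -> : @GRing.inv R = (fun x => x * (x ^+ 2) `^ (-1)).
  apply/funext => x; rewrite powR_inv1 ?sqr_ge0//.
  have [->|x0] := eqVneq x 0; first by rewrite invr0 mul0r.
  by rewrite expr2 invfM mulVKf.
apply: measurable_funM => //.
exact: (measurableT_comp (@measurable_powR R (-1)) (exprn_measurable 2)).
Qed.

(* Discretizing the second variable makes a Carathéodory function a pointwise
   limit of measurable functions. *)
Lemma caratheodory_measurable d (T : measurableType d) (f : T * R -> R) :
  (forall x, continuous (fun y => f (x, y))) ->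
  (forall y, measurable_fun setT (fun x => f (x, y))) ->
  measurable_fun [set: T * measurableTypeR R] f.
Proof.
move=> cf mf.
pose q (n : nat) (y : R) : R := (Num.floor (y * n.+1%:R))%:~R / n.+1%:R.
apply: (@measurable_fun_cvg _ _ _ _ (fun n z => f (z.1, q n z.2))) => [n|[x y] _ /=].
- move=> _ B mB; rewrite setTI.
  (* Sorting by the grid value k/(n+1) splits the preimage into countably many rectangles. *)
  have -> : (fun z : T * R => f (z.1, q n z.2)) @^-1` B =
      \bigcup_(k : int) (((fun x => f (x, k%:~R / n.+1%:R)) @^-1` B) `*`
        `[k%:~R / n.+1%:R, (k + 1)%:~R / n.+1%:R[%classic).
    apply/seteqP; split => [[x y] /= Bf|[x y] [k _] /= [Bf]].
      exists (Num.floor (y * n.+1%:R)) => //=; split => //.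
      by rewrite in_itv/= ler_pdivrMr// ltr_pdivlMr// floor_itv.
    rewrite in_itv/= ler_pdivrMr// ltr_pdivlMr// => ky.
    by rewrite /q (floor_def ky).
  apply: countable_bigcupT_measurable => // k.
  apply: measurableX => //.
  by rewrite -[X in measurable X]setTI; exact: mf.
- apply: (cvg_comp (fun n => q n y) (fun t => f (x, t))); last exact: cf.
  apply/cvgrPdist_le => e e0; near=> n.
  have n0 : (0 : R) < n.+1%:R by [].
  rewrite /q -[y in y - _](mulfK (lt0r_neq0 n0)) -mulrBl normrM normfV.
  rewrite (gtr0_norm n0) ler_pdivrMr//.
  have /andP[h1] := floor_itv (y * n.+1%:R); rewrite intrD => h2; rewrite ger0_norm ?subr_ge0//.
  apply: (@le_trans _ _ 1); first by lra.
  rewrite -ler_pdivrMr// div1r ltW//; near: n.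
  exact: (near_infty_natSinv_lt (PosNum e0)).
Unshelve. all: by end_near. Qed.

(** Passes from the product topology to the product sigma-algebra, by the Carathéodory criterion
    applied once per product. *)
Lemma continuous_measurable3 (f : R * R * R -> R) : continuous f ->
  measurable_fun [set: R3] f.
Proof.
move=> cf; apply: caratheodory_measurable => [x y|z].
  apply: (continuous_comp _ (cf (x, y))).
  by apply: continuous_pair; [exact: cvg_cst|exact: cvg_id].
apply: (@caratheodory_measurable _ (measurableTypeR R) (fun p => f (p, z))) => [x y|y].
  apply: (continuous_comp _ (cf ((x, y), z))).
  apply: continuous_pair; last exact: cvg_cst.
  by apply: continuous_pair; [exact: cvg_cst|exact: cvg_id].
apply: continuous_measurable_fun => x.
apply: (continuous_comp _ (cf ((x, y), z))).
apply: continuous_pair; last exact: cvg_cst.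
by apply: continuous_pair; [exact: cvg_id|exact: cvg_cst].
Qed.

End measurability.

(** * Direction cosines *)

Lemma ord3_ind (P : 'I_3 -> Prop) : P 0 -> P 1 -> P 2 -> forall i, P i.
Proof.
move=> P0 P1 P2 [[|[|[|//]]] i3].
- by rewrite (_ : Ordinal i3 = 0)//; apply: val_inj.
- by rewrite (_ : Ordinal i3 = 1)//; apply: val_inj.
- by rewrite (_ : Ordinal i3 = 2)//; apply: val_inj.
Qed.

Lemma sum3 (V : zmodType) (F : 'I_3 -> V) : \sum_(j < 3) F j = F 0 + F 1 + F 2.
Proof.
rewrite !big_ord_recl big_ord0 addr0 addrA.
by congr (_ + _ + _); congr F; apply: val_inj.
Qed.

Section directions.
Context {R : realType}.
Notation R3 := (measurableTypeR R * measurableTypeR R * measurableTypeR R)%type.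
Implicit Types (x y : R * R * R) (i j k : 'I_3) (t : R).

(** Direction cosine. Its value at the origin is 0, so the bound by 1 holds everywhere. *)
Definition dir j x : R := coord j x / enorm x.

Lemma coordZ j t x : coord j (t *: x) = t * coord j x.
Proof. by elim/ord3_ind: j. Qed.

Lemma coordD j x y : coord j (x + y) = coord j x + coord j y.
Proof. by elim/ord3_ind: j. Qed.

Lemma coord_basis3 i j : coord i (@basis3 R j) = (i == j)%:R.
Proof. by elim/ord3_ind: i; elim/ord3_ind: j. Qed.

Lemma coord_line i j x t : coord i (x + t *: basis3 R j) = coord i x + t * (i == j)%:R.
Proof. by rewrite coordD coordZ coord_basis3. Qed.

Lemma enorm_sqr x : enorm x ^+ 2 = \sum_(j < 3) coord j x ^+ 2.
Proof. by rewrite sqr_sqrtr// sumr_ge0// => j _; rewrite sqr_ge0. Qed.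

Lemma enorm_ge0 x : 0 <= enorm x. Proof. exact: sqrtr_ge0. Qed.

Lemma coord_le_enorm j x : `|coord j x| <= enorm x.
Proof.
rewrite -(@ler_pXn2r _ 2) ?nnegrE ?enorm_ge0// real_normK ?num_real//.
by rewrite enorm_sqr (bigD1 j)//= lerDl sumr_ge0// => i _; rewrite sqr_ge0.
Qed.

Lemma enorm0 : enorm (0 : R * R * R) = 0.
Proof.
by rewrite /enorm big1 ?sqrtr0// => j _; elim/ord3_ind: j; rewrite /= expr0n.
Qed.

Lemma enorm_gt0 x : (0 < enorm x) = (x != 0).
Proof.
rewrite lt_neqAle enorm_ge0 andbT eq_sym; congr (~~ _).
apply/idP/eqP => [/eqP x0|->].
  have c0 j : coord j x = 0.
    by apply/eqP; rewrite -normr_le0 -x0 coord_le_enorm.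
  move: x {x0} c0 => [[a b] c] c0.
  by rewrite (c0 0 : a = 0) (c0 1 : b = 0) (c0 2 : c = 0).
by rewrite enorm0.
Qed.

Lemma enormZ t x : enorm (t *: x) = `|t| * enorm x.
Proof.
rewrite /enorm; under eq_bigr do rewrite coordZ exprMn.
by rewrite -mulr_sumr sqrtrM ?sqr_ge0// sqrtr_sqr.
Qed.

Lemma dirZ j t x : 0 < t -> dir j (t *: x) = dir j x.
Proof.
by move=> t0; rewrite /dir coordZ enormZ gtr0_norm// -mulf_div divff ?mul1r ?gt_eqF.
Qed.

Lemma dir_le1 j x : `|dir j x| <= 1.
Proof.
have [->|] := eqVneq x 0.
  by rewrite /dir enorm0 invr0 mulr0 normr0.
rewrite -enorm_gt0 => x0.
rewrite /dir normrM normfV (gtr0_norm x0) ler_pdivrMr// mul1r.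
exact: coord_le_enorm.
Qed.

Lemma sum_dir_sqr x : x != 0 -> \sum_(j < 3) dir j x ^+ 2 = 1.
Proof.
rewrite -enorm_gt0 => x0.
under eq_bigr do rewrite /dir expr_div_n.
by rewrite -mulr_suml -enorm_sqr divff// expf_neq0// gt_eqF.
Qed.

Lemma measurable_coord j : measurable_fun [set: R3] (coord j).
Proof.
elim/ord3_ind: j.
- exact: (measurableT_comp measurable_fst (@measurable_fst _ _ _ _)).
- exact: (measurableT_comp measurable_snd (@measurable_fst _ _ _ _)).
- exact: measurable_snd.
Qed.

Lemma measurable_enorm : measurable_fun [set: R3] (@enorm R).
Proof.
apply: measurableT_comp; first exact: continuous_measurable_fun (@sqrt_continuous R).
rewrite (_ : (fun x => _) = (fun x => coord 0 x ^+ 2 + coord 1 x ^+ 2 + coord 2 x ^+ 2)).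
  have m j := measurable_funX 2 (measurable_coord j).
  exact: (measurable_funD (measurable_funD (m 0) (m 1)) (m 2)).
by apply/funext => x; rewrite sum3.
Qed.

Lemma measurable_dir j : measurable_fun [set: R3] (dir j).
Proof.
apply: measurable_funM; first exact: measurable_coord.
by apply: measurableT_comp; [exact: measurable_inv|exact: measurable_enorm].
Qed.

Lemma is_derive_coord_line i j x t :
  is_derive t 1 (fun t => coord i (x + t *: basis3 R j)) (i == j)%:R.
Proof.
rewrite (_ : (fun _ => _) = (fun t => coord i x + t * (i == j)%:R)).
  by apply: is_derive_eq; rewrite add0r mul1r scaler0 add0r; exact: mulr1.
by apply/funext => u; rewrite coord_line.
Qed.

Lemma is_derive_enorm_line j x t : x + t *: basis3 R j != 0 ->
  is_derive t 1 (fun t => enorm (x + t *: basis3 R j)) (dir j (x + t *: basis3 R j)).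
Proof.
rewrite -enorm_gt0 => x0.
have dq : is_derive t 1 (fun t => \sum_(i < 3) coord i (x + t *: basis3 R j) ^+ 2)
    (2 * coord j (x + t *: basis3 R j)).
  rewrite (_ : (fun _ => _) = (fun t => \sum_(i < 3) coord i x ^+ 2 +
      2 * coord j x * t + t ^+ 2)).
    by apply: is_derive_eq; rewrite coord_line eqxx mulr1 /GRing.scale/=; ring.
  apply/funext => u; rewrite !sum3 !coord_line.
  by elim/ord3_ind: j {x0} => /=; ring.
have q0 : 0 < \sum_(i < 3) coord i (x + t *: basis3 R j) ^+ 2.
  by rewrite -enorm_sqr exprn_gt0.
apply: (is_derive_eq (is_derive1_comp (is_derive1_sqrt q0) dq)).
rewrite -[Num.sqrt _]/(enorm _) /dir; field.
by rewrite gt_eqF.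
Qed.

Lemma is_derive_enormV_line j x t : x + t *: basis3 R j != 0 ->
  is_derive t 1 (fun t => (enorm (x + t *: basis3 R j))^-1)
    (- dir j (x + t *: basis3 R j) / enorm (x + t *: basis3 R j) ^+ 2).
Proof.
move=> x0; have := x0; rewrite -enorm_gt0 => /lt0r_neq0 n0.
apply: (is_derive_eq (@is_deriveV _
  (fun t => enorm (x + t *: basis3 R j)) _ _ _ n0 (is_derive_enorm_line x0))).
by rewrite /GRing.scale/=; field.
Qed.

Lemma is_derive_dir_line i j x t : x + t *: basis3 R j != 0 ->
  let y := x + t *: basis3 R j in
  is_derive t 1 (fun t => dir i (x + t *: basis3 R j))
    (((i == j)%:R - dir i y * dir j y) / enorm y).
Proof.
move=> x0 y; have := x0; rewrite -enorm_gt0 => /lt0r_neq0 n0.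
apply: (is_derive_eq (is_deriveM (is_derive_coord_line i j x t)
  (is_derive_enormV_line x0))).
by rewrite /dir /GRing.scale/= -/y; field.
Qed.

End directions.

(** * The cosine along a ray as a variable of integration *)

Section slope.
Context {R : realType}.
Notation mu := (@lebesgue_measure R).
Variable k : R.
Hypothesis k0 : 0 < k.

(* For the ray through (a, 1, w) and k = 1 + w^2, [slope a] is the cosine
   t = x_1/|x|, and dt = k / hyp^3 da turns integrals over a into integrals over
   [-1, 1]. *)
Definition hyp (a : R) := Num.sqrt (a ^+ 2 + k).
Definition slope (a : R) := a / hyp a.

Lemma hyp_sqr a : hyp a ^+ 2 = a ^+ 2 + k.
Proof. by rewrite sqr_sqrtr// addr_ge0 ?sqr_ge0 ?ltW. Qed.

Lemma hyp_gt0 a : 0 < hyp a.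
Proof. by rewrite sqrtr_gt0 ltr_wpDl ?sqr_ge0. Qed.

Lemma hypN a : hyp (- a) = hyp a.
Proof. by rewrite /hyp sqrrN. Qed.

Lemma slope0 : slope 0 = 0.
Proof. by rewrite /slope mul0r. Qed.

Lemma slopeN a : slope (- a) = - slope a.
Proof. by rewrite /slope hypN mulNr. Qed.

Lemma slope_lt1 a : `|slope a| < 1.
Proof.
rewrite normrM normfV (gtr0_norm (hyp_gt0 a)) ltr_pdivrMr ?hyp_gt0// mul1r.
rewrite -(@ltr_pXn2r _ 2) ?nnegrE ?(ltW (hyp_gt0 _))//.
by rewrite real_normK ?num_real// hyp_sqr ltrDl.
Qed.

Lemma is_derive_hyp (a : R) : is_derive a 1 hyp (slope a).
Proof.
have q0 : 0 < a ^+ 2 + k by rewrite ltr_wpDl ?sqr_ge0.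
have dq : is_derive a 1 (fun a => a ^+ 2 + k) (2 * a).
  by apply: is_derive_eq; rewrite /GRing.scale/=; ring.
rewrite -[hyp]/(Num.sqrt \o (fun a => a ^+ 2 + k)).
apply: (is_derive_eq (@is_derive1_comp _ _ (fun a => a ^+ 2 + k) _ _ _ (is_derive1_sqrt q0) dq)).
rewrite /slope -[Num.sqrt _]/(hyp _); field.
by rewrite gt_eqF ?hyp_gt0.
Qed.

Lemma is_derive_slope (a : R) : is_derive a 1 slope (k / hyp a ^+ 3).
Proof.
have h0 : hyp a != 0 by rewrite gt_eqF ?hyp_gt0.
apply: (is_derive_eq (is_deriveM (is_derive_id a 1)
  (@is_deriveV _ hyp _ _ _ h0 (is_derive_hyp a)))).
rewrite /GRing.scale/= /slope.
have -> : k = hyp a ^+ 2 - a ^+ 2 by rewrite hyp_sqr addrAC subrr add0r.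
by field.
Qed.

Lemma continuous_hyp : continuous hyp.
Proof. by move=> a; exact: (is_derive_continuous (is_derive_hyp a)). Qed.

Lemma continuous_hypV3 : continuous (fun a => (hyp a ^+ 3)^-1).
Proof.
move=> a; apply: cvgV; first by rewrite expf_neq0// gt_eqF ?hyp_gt0.
apply: (@continuous_comp _ _ _ hyp (fun x => x ^+ 3)); first exact: continuous_hyp.
exact: exprn_continuous.
Qed.

Lemma continuous_slope : continuous slope.
Proof. by move=> a; exact: (is_derive_continuous (is_derive_slope a)). Qed.

Lemma cvg_slope : slope a @[a --> +oo] --> (1 : R).
Proof.
apply/cvgrPdist_le => e e0; near=> a.
have a0 : 0 < a by near: a; exact: (nbhs_pinfty_gt (num_real _)).
have ha : a <= hyp a.
  by rewrite -(@ler_pXn2r _ 2) ?nnegrE ?(ltW a0) ?(ltW (hyp_gt0 _))// hyp_sqr lerDl ltW.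
(* Multiplication by the conjugate, with k = hyp^2 - a^2. *)
have -> : 1 - slope a = k / (hyp a * (hyp a + a)).
  have -> : k = hyp a ^+ 2 - a ^+ 2 by rewrite hyp_sqr addrAC subrr add0r.
  by rewrite /slope; field; rewrite !gt_eqF ?hyp_gt0// addr_gt0 ?hyp_gt0.
rewrite ger0_norm; last by rewrite divr_ge0 ?mulr_ge0 ?addr_ge0 ?(ltW (hyp_gt0 _)) ?ltW.
(* The first summand gives k <= e a; the summand 1 gives 1 <= hyp a, which takes care of the other
   factor of the denominator. *)
have ak : k / e + 1 <= a by near: a; exact: (nbhs_pinfty_ge (num_real _)).
rewrite ler_pdivrMr ?mulr_gt0 ?addr_gt0 ?hyp_gt0//.
have ke : k <= e * a.
  by rewrite -ler_pdivrMl// mulrC (le_trans _ ak)// lerDl.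
apply: (le_trans ke); rewrite ler_pM2l//.
have a1 : 1 <= hyp a.
  by apply: le_trans ha; apply: le_trans ak; rewrite lerDr divr_ge0// ltW.
nra.
Unshelve. all: by end_near. Qed.

Lemma has_integral_hypV3 : has_integral mu (fun a => (hyp a ^+ 3)^-1) (2 / k).
Proof.
have := @has_integral_even R (fun a => (hyp a ^+ 3)^-1) (fun a => k^-1 * slope a) (k^-1 * 1).
rewrite slope0 mulr0 subr0 mulr1 => H; apply: H.
- by move=> a; rewrite invr_ge0 exprn_ge0// ltW ?hyp_gt0.
- exact: continuous_hypV3.
- by move=> a; rewrite hypN.
- move=> a; apply: (is_derive_eq (is_deriveM (is_derive_cst k^-1 a 1) (is_derive_slope a))).
  by rewrite /GRing.scale/=; field; rewrite !gt_eqF ?hyp_gt0.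
- by rewrite -[X in _ --> X]mulr1; apply: cvgM; [exact: cvg_cst|exact: cvg_slope].
Qed.

(** Substitution t = slope a, carried out by composing the antiderivative with [slope]. The sum over
    the two signs comes from the two half-lines of a line through the origin. *)
Lemma has_integral_slope (G g : R -> R) (C : R) :
  (forall t : R, `|t| <= 1 -> is_derive t 1 G (g t)) ->
  (forall t : R, `|t| <= 1 -> {for t, continuous g}) ->
  (forall t : R, `|t| <= 1 -> `|g t| <= C) ->
  has_integral mu (fun a => (g (slope a) + g (- slope a)) / hyp a ^+ 3)
    (2 * (G 1 - G (- 1)) / k).
Proof.
move=> dG cg gC.
(* Adding 2 C / hyp^3 makes the integrand nonnegative, as [has_integral_even] requires; its known
   integral is subtracted at the end. *)
pose F a := k^-1 * (G (slope a) - G (- slope a) + 2 * C * slope a).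
pose f a := (g (slope a) + g (- slope a) + 2 * C) / hyp a ^+ 3.
have s1 a := ltW (slope_lt1 a).
have hf : has_integral mu f (2 * (k^-1 * (G 1 - G (- 1) + 2 * C * 1) - F 0)).
  apply: has_integral_even.
  - move=> a; rewrite divr_ge0 ?exprn_ge0 ?(ltW (hyp_gt0 _))//.
    have := gC _ (s1 a); have := gC (- slope a); rewrite normrN => /(_ (s1 a)).
    by rewrite !ler_norml => /andP[h1 _] /andP[h2 _]; lra.
  - move=> a; apply: cvgM; last exact: continuous_hypV3.
    apply: cvgD; last exact: cvg_cst.
    apply: cvgD.
      apply: (@continuous_comp _ _ _ slope g); first exact: continuous_slope.
      exact: cg.
    apply: (@continuous_comp _ _ _ (fun a => - slope a) g).
      by apply: cvgN; exact: continuous_slope.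
    by apply: cg; rewrite normrN.
  - by move=> a; rewrite /f slopeN opprK hypN (addrC (g _)).
  - move=> a.
    have d1 := is_derive1_comp (dG _ (s1 a)) (is_derive_slope a).
    have sN1 : `|- slope a| <= 1 by rewrite normrN.
    have d2 := @is_derive1_comp _ G (- slope) a _ _ (dG _ sN1) (is_deriveN (is_derive_slope a)).
    have d3 := is_deriveM (is_derive_cst (2 * C) a 1) (is_derive_slope a).
    have := is_deriveM (is_derive_cst k^-1 a 1) (is_deriveD (is_deriveB d1 d2) d3).
    move=> d4; apply: (is_derive_eq d4).
    by rewrite /f /GRing.scale/=; field; rewrite !gt_eqF ?hyp_gt0.
  - have sc := cvg_slope.
    have n1 : `|1 : R| <= 1 by rewrite normr1.
    have nN1 : `|- 1 : R| <= 1 by rewrite normrN normr1.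
    apply: cvgM; first exact: cvg_cst.
    apply: cvgD; last by apply: cvgM => //; exact: cvg_cst.
    apply: cvgB; first by apply: cvg_comp sc _; exact: is_derive_continuous (dG _ n1).
    have sN : - slope a @[a --> +oo] --> (- 1 : R) by exact: cvgN.
    by apply: cvg_comp sN _; exact: is_derive_continuous (dG _ nN1).
have := has_integralD hf (has_integralZ (- (2 * C)) has_integral_hypV3).
rewrite {1}/F slope0 oppr0 subrr mulr0 addr0 mulr0 subr0.
rewrite (_ : _ + _ = 2 * (G 1 - G (- 1)) / k); last first.
  by field; rewrite gt_eqF.
by apply: has_integral_eq => a; rewrite /f/=; field; rewrite gt_eqF ?hyp_gt0.
Qed.

End slope.

Lemma has_integral_oneDsqrV (R : realType) :
  has_integral (@lebesgue_measure R) (fun w => (1 + w ^+ 2)^-1) pi.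
Proof.
have := @has_integral_even R (fun w => (1 + w ^+ 2)^-1) atan (pi / 2).
rewrite atan0 subr0 (_ : 2 * (pi / 2) = pi); last by field.
apply.
- by move=> x; rewrite invr_ge0 addr_ge0 ?sqr_ge0.
- exact: continuous_oneDsqrV.
- by move=> x; rewrite sqrrN.
- exact: cvgy_atan.
Qed.

(** * Local integrability of |x|^-2 in space *)

Section ball.
Context {R : realType}.
Notation mu := (@lebesgue_measure R).
Notation R3 := (measurableTypeR R * measurableTypeR R * measurableTypeR R)%type.

Lemma ray_pointE (z : R * R * R) : ray_point z = z.1.1 *: ((z.1.2, 1), z.2).
Proof.
transitivity (((z.1.1 * z.1.2, z.1.1 * 1), z.1.1 * z.2)); last by [].
by rewrite mulr1.
Qed.

Lemma enorm_axis (a w : R) : enorm ((a, 1), w) = hyp (1 + w ^+ 2) a.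
Proof. rewrite /enorm sum3 -[X in Num.sqrt X]/(a ^+ 2 + 1 ^+ 2 + w ^+ 2).
by rewrite expr1n -addrA. Qed.

Lemma integral_centered_interval (m c : R) : 0 < m ->
  (\int[mu]_y (if `|y| < m then c else 0)%:E = (2 * m * c)%:E)%E.
Proof.
move=> m0.
transitivity (\int[mu]_y (((cst c%:E) \_ [set` `]- m, m[%R]) y))%E.
  apply: eq_integral => y _; rewrite patchE mem_setE in_itv/= -ltr_norml.
  by case: ifP.
rewrite -integral_mkcond integral_cst//.
transitivity (c%:E * mu [set` `]- m, m[%R])%E => //.
rewrite lebesgue_measure_itv/= lte_fin.
rewrite ifT; last by lra.
by rewrite -EFinB -EFinM; congr (_%:E); ring.
Qed.

(** In projective coordinates the Jacobian cancels |y|^-2. With N = |(a, 1, w)|, integrating over y,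
    a and w gives successively 2 M / N^3, 4 M / (1 + w^2) and 4 pi M. *)
Lemma integrable_ball (M : R) : 0 < M ->
  (@lebesgue3 R).-integrable [set: R * R * R]
    (EFin \o (fun x => if enorm x < M then (enorm x ^+ 2)^-1 else 0)).
Proof.
move=> M0; set f := fun x => _.
have mf : measurable_fun [set: R3] (EFin \o f).
  apply/measurable_EFinP; apply: measurable_fun_ifT => //.
    by apply: measurable_fun_ltr => //; exact: measurable_enorm.
  apply: (measurableT_comp measurable_inv); apply: measurable_funX.
  exact: measurable_enorm.
have f0 x : 0 <= f x by rewrite /f; case: ifP => // _; rewrite invr_ge0 sqr_ge0.
apply/integrableP; split => //.
under eq_integral => x _ do rewrite /= ger0_norm//.
rewrite -[X in (X < _)%E]/(\int[@lebesgue3 R]_x ((EFin \o f) x))%E.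
rewrite ge0_integral_ray_point//.
pose N (a w : R) : R := enorm ((a, 1), w).
have N0 a w : 0 < N a w.
  by rewrite enorm_gt0; apply/eqP => -[_ /eqP]; rewrite oner_eq0.
pose g (z : R * R * R) : R :=
  if `|z.1.1| < M / N z.1.2 z.2 then (N z.1.2 z.2 ^+ 2)^-1 else 0.
have mN : measurable_fun [set: R3] (fun z => N z.1.2 z.2).
  apply: (measurableT_comp measurable_enorm).
  apply: measurable_fun_pair => //; apply: measurable_fun_pair => //.
  exact: (measurableT_comp measurable_snd measurable_fst).
have mg : measurable_fun [set: R3] (EFin \o g).
  have mNV := measurableT_comp measurable_inv mN.
  apply/measurable_EFinP; apply: measurable_fun_ifT => //.
    apply: measurable_fun_ltr.
      have m1 : measurable_fun [set: R3] (fun z => z.1.1 : R).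
        exact: (measurableT_comp measurable_fst measurable_fst).
      exact: (measurableT_comp (@normr_measurable R setT) m1).
    exact: measurable_funM.
  by apply: (measurableT_comp measurable_inv); exact: measurable_funX.
have g0 z : 0 <= g z by rewrite /g; case: ifP => // _; rewrite invr_ge0 sqr_ge0.
(* Only an inequality is claimed: at y = 0 the Jacobian makes the left integrand 0, while [g] is
   positive there. *)
apply: (@le_lt_trans _ _ (\int[@lebesgue3 R]_z (EFin \o g) z)%E).
  apply: ge0_le_integral => //.
  - by move=> z _; apply: mule_ge0; rewrite lee_fin ?sqr_ge0//; exact: f0.
  - apply: emeasurable_funM.
      by apply/measurable_EFinP; apply: measurable_funX; apply: measurableT_comp.
    exact: (measurableT_comp mf measurable_ray_point).
  - move=> z _ /=; rewrite -EFinM lee_fin /f /g ray_pointE enormZ -/(N _ _).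
    rewrite ltr_pdivlMr//; case: ifP => _; last by rewrite mulr0.
    have [->|y0] := eqVneq z.1.1 0; first by rewrite expr0n mul0r invr_ge0 sqr_ge0.
    rewrite exprMn real_normK ?num_real// invfM mulrA divff ?mul1r//.
    by rewrite expf_neq0.
rewrite [X in (X < _)%E](fubini_tonelli2 (m1 := lebesgue2) (m2 := mu) _ mg)//.
have e1 (a w : R) : (\int[mu]_y (g ((y, a), w))%:E =
    (2 * M * (hyp (1 + w ^+ 2) a ^+ 3)^-1)%:E)%E.
  rewrite /g/= integral_centered_interval ?divr_gt0//.
  rewrite /N enorm_axis; congr (_%:E); field.
  by rewrite -enorm_axis gt_eqF ?N0.
have e2 (w : R) : (\int[mu]_a \int[mu]_y (g ((y, a), w))%:E =
    (4 * M * (1 + w ^+ 2)^-1)%:E)%E.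
  have k0 : 0 < 1 + w ^+ 2 by rewrite ltr_pwDl ?sqr_ge0.
  have [_ h] := has_integralZ (2 * M) (has_integral_hypV3 k0).
  transitivity ((2 * M * (2 / (1 + w ^+ 2)))%:E); last first.
    by congr (_%:E); field; rewrite gt_eqF.
  by rewrite -h; apply: eq_integral => a _; rewrite e1.
have [_ e3] := has_integralZ (4 * M) (@has_integral_oneDsqrV R).
rewrite [X in (X < _)%E](_ : _ = (4 * M * pi)%:E) ?ltry//.
rewrite -e3; apply: eq_integral => w _; rewrite -e2 /fubini_G.
rewrite [LHS](fubini_tonelli2 (m1 := mu) (m2 := mu) (fun p => (g (p, w))%:E))//.
  exact: (measurable_fun_pair1 w mg).
by move=> p; rewrite lee_fin.
Qed.

End ball.

(** Domination by [integrable_ball]. At the origin the bound reads |h 0| <= 0, because the inverse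
    of 0 is 0; quotients by |x| comply. *)
Lemma integrable_enormV2 (R : realType) (h : R * R * R -> R) (C M : R) : 0 < M ->
  measurable_fun [set: measurableTypeR R * measurableTypeR R * measurableTypeR R] h ->
  (forall x, enorm x >= M -> h x = 0) ->
  (forall x, `|h x| <= C * (enorm x ^+ 2)^-1) ->
  (@lebesgue3 R).-integrable [set: R * R * R] (EFin \o h).
Proof.
move=> M0 mh hM hC.
have := integrableZl measurableT C (integrable_ball M0).
apply: le_integrable => //; first exact/measurable_EFinP.
move=> x _; rewrite /= lee_fin.
have [xM|Mx] := ltP; last by rewrite hM// normr0.
by rewrite (le_trans (hC x))// ler_norm.
Qed.

(** * Angular expressions *)

(* Polynomial expressions in the direction cosines x_j/|x| and in
   e := |x|/(c|x| - x_1): up to powers of |x|, the Landau fields and all their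
   derivatives are of this form, and bounds, measurability, homogeneity and
   derivatives are obtained once and for all by induction. *)
Inductive aexp (R : realType) :=
| ADir of 'I_3
| ARes
| ACst of R
| AAdd of aexp R & aexp R
| AMul of aexp R & aexp R.

Arguments ADir {R}.
Arguments ARes {R}.

Section angular_expressions.
Context {R : realType}.
Notation R3 := (measurableTypeR R * measurableTypeR R * measurableTypeR R)%type.
Variable c : R.
Hypothesis c1 : 1 < `|c|.
Implicit Types (s : aexp R) (x y : R * R * R) (i j k : 'I_3).

Fixpoint aval s x : R :=
  match s with
  | ADir j => dir j x
  | ARes => (c - dir 0 x)^-1
  | ACst a => a
  | AAdd s1 s2 => aval s1 x + aval s2 x
  | AMul s1 s2 => aval s1 x * aval s2 x
  end.

(* |x| times the j-th partial derivative *)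
Fixpoint ader j s : aexp R :=
  match s with
  | ADir i => AAdd (ACst (i == j)%:R) (AMul (ACst (-1)) (AMul (ADir i) (ADir j)))
  | ARes => AMul (AMul ARes ARes)
      (AAdd (ACst (0 == j)%:R) (AMul (ACst (-1)) (AMul (ADir 0) (ADir j))))
  | ACst _ => ACst 0
  | AAdd s1 s2 => AAdd (ader j s1) (ader j s2)
  | AMul s1 s2 => AAdd (AMul (ader j s1) s2) (AMul s1 (ader j s2))
  end.

(* |x|^2 times the j-th partial derivative of s/|x| *)
Definition agrad j s := AAdd (ader j s) (AMul (ACst (-1)) (AMul (ADir j) s)).

(** With |c| > 1 this keeps the denominator of [ARes] away from 0, uniformly in x and even at the
    origin. *)
Lemma sub_dir_ge x : `|c| - 1 <= `|c - dir 0 x|.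
Proof. by rewrite (le_trans _ (lerB_dist _ _))// lerB// dir_le1. Qed.

Lemma sub_dir_neq0 x : c - dir 0 x != 0.
Proof. by rewrite -normr_gt0 (lt_le_trans _ (sub_dir_ge x))// subr_gt0. Qed.

Lemma aval_bounded s : exists2 C : R, 0 <= C & forall x, `|aval s x| <= C.
Proof.
elim: s => [j||a|s1 [C1 C10 h1] s2 [C2 C20 h2]|s1 [C1 C10 h1] s2 [C2 C20 h2]].
- by exists 1 => // x; exact: dir_le1.
- exists (`|c| - 1)^-1 => [|x]; first by rewrite invr_ge0 subr_ge0 ltW.
  by rewrite /= normfV lef_pV2 ?sub_dir_ge// posrE ?subr_gt0// normr_gt0 sub_dir_neq0.
- by exists `|a|.
- exists (C1 + C2) => [|x]; first exact: addr_ge0.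
  by rewrite /= (le_trans (ler_normD _ _))// lerD.
- exists (C1 * C2) => [|x]; first exact: mulr_ge0.
  by rewrite /= normrM ler_pM.
Qed.

Lemma measurable_aval s : measurable_fun [set: R3] (aval s).
Proof.
elim: s => [j||a|s1 h1 s2 h2|s1 h1 s2 h2] /=.
- exact: measurable_dir.
- apply: (measurableT_comp measurable_inv); apply: measurable_funB => //.
  exact: measurable_dir.
- exact: measurable_cst.
- exact: measurable_funD.
- exact: measurable_funM.
Qed.

Lemma avalZ s t x : 0 < t -> aval s (t *: x) = aval s x.
Proof.
by move=> t0; elim: s => [j||a|s1 h1 s2 h2|s1 h1 s2 h2] /=; rewrite ?dirZ ?h1 ?h2.
Qed.

Lemma is_derive_aval_line s j x (t : R) : x + t *: basis3 R j != 0 ->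
  let y := x + t *: basis3 R j in
  is_derive t 1 (fun t => aval s (x + t *: basis3 R j)) (aval (ader j s) y / enorm y).
Proof.
move=> x0 y; have := x0; rewrite -enorm_gt0 => /lt0r_neq0 n0.
elim: s => [i||a|s1 h1 s2 h2|s1 h1 s2 h2] /=.
- apply: (is_derive_eq (is_derive_dir_line i x0)).
  by rewrite -/y; congr (_ / _); ring.
- have s0 := sub_dir_neq0 y.
  have d := is_deriveB (is_derive_cst c t 1) (is_derive_dir_line 0 x0).
  apply: (is_derive_eq (@is_deriveV _ (fun t => c - dir 0 (x + t *: basis3 R j))
    _ _ _ s0 d)).
  by rewrite -/y /GRing.scale/=; field; rewrite n0.
- by rewrite mul0r; exact: is_derive_cst.
- by apply: (is_derive_eq (is_deriveD h1 h2)); rewrite mulrDl.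
- apply: (is_derive_eq (is_deriveM h1 h2)).
  by rewrite -/y /GRing.scale/=; ring.
Qed.

Lemma is_derive_aval_enormV_line s j x (t : R) : x + t *: basis3 R j != 0 ->
  let y := x + t *: basis3 R j in
  is_derive t 1 (fun t => aval s (x + t *: basis3 R j) / enorm (x + t *: basis3 R j))
    (aval (agrad j s) y / enorm y ^+ 2).
Proof.
move=> x0 y; have := x0; rewrite -enorm_gt0 => /lt0r_neq0 n0.
apply: (is_derive_eq (is_deriveM (is_derive_aval_line s x0) (is_derive_enormV_line x0))).
by rewrite -/y /GRing.scale/=; field.
Qed.

End angular_expressions.

(** * Smooth functions *)

Section lines_derivative.
Context {R : realType} {V W : normedModType R}.

Lemma is_derive_line (f : V -> W) (x v : V) (t : R) : derivable f (x + t *: v) v ->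
  is_derive t 1 (fun t => f (x + t *: v)) ('D_v f (x + t *: v)).
Proof.
have e : (fun h : R => h^-1 *: (((fun t => f (x + t *: v)) \o shift t) (h *: 1)
      - f (x + t *: v))) =
    (fun h => h^-1 *: ((f \o shift (x + t *: v)) (h *: v) - f (x + t *: v))).
  apply/funext => h /=; congr (_ *: (f _ - _)).
  by rewrite -[h *: 1]/(h * 1) mulr1 scalerDl addrCA.
by move=> df; split; rewrite /derivable /derive e.
Qed.

Lemma derive_line0 (f : V -> W) (x v : V) (d : W) :
  is_derive (0 : R) 1 (fun t => f (x + t *: v)) d -> is_derive x v f d.
Proof.
have e : (fun h : R => h^-1 *: (((fun t => f (x + t *: v)) \o shift 0) (h *: 1)
      - f (x + 0 *: v))) =
    (fun h => h^-1 *: ((f \o shift x) (h *: v) - f x)).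
  apply/funext => h /=; congr (_ *: (f _ - _)); last by rewrite scale0r addr0.
  by rewrite -[h *: 1]/(h * 1) mulr1 addr0 addrC.
by case; rewrite /derivable /derive e => ? ?; split.
Qed.

End lines_derivative.

(** A mean value theorem for increments of either sign, with the intermediate point controlled in
    absolute value. *)
Lemma MVT_abs (R : realType) (f df : R -> R) (s : R) :
  (forall t : R, is_derive t 1 f (df t)) ->
  exists2 u, `|u| <= `|s| & f s - f 0 = s * df u.
Proof.
move=> d; have cf : continuous f by move=> t; exact: is_derive_continuous (d t).
have [s0|s0] := leP 0 s.
  have [|u] := @MVT_segment R f df _ _ s0 (fun t _ => d t).
    exact: continuous_subspaceT.
  rewrite in_itv/= subr0 => /andP[u0 us] ->; exists u; last exact: mulrC.
  by rewrite !ger0_norm.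
have [|u] := @MVT_segment R f df _ _ (ltW s0) (fun t _ => d t).
  exact: continuous_subspaceT.
rewrite in_itv/= sub0r => /andP[su u0] e; exists u.
  by rewrite !ler0_norm ?lerN2// ltW.
by rewrite -opprB e mulrN opprK mulrC.
Qed.

(** * Mean values and symmetry of second partial derivatives *)

Section smooth_functions.
Context {R : realType}.
Notation R3 := (measurableTypeR R * measurableTypeR R * measurableTypeR R)%type.
Implicit Types (f : R * R * R -> R) (x y v : R * R * R) (i j k : 'I_3).

Definition C1 f := continuous f /\ forall k,
  continuous (partial k f) /\ forall x, derivable f x (@basis3 R k).

Lemma smooth_C1 f s : smooth f -> C1 (iter_partial s f).
Proof.
move=> sf; split=> [|k]; first by have [] := sf s.
by have [_ ds] := sf s; have [] := sf (k :: s).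
Qed.

Lemma continuous_coords f x (e : R) : {for x, continuous f} -> 0 < e ->
  exists2 d : R, 0 < d & forall y, (forall i, `|coord i y - coord i x| < d) ->
    `|f y - f x| < e.
Proof.
move=> cf e0.
have /nbhs_ballP[d/= d0 H] : \forall y \near x, `|f x - f y| < e.
  by move/cvgrPdist_lt : cf; exact.
exists d => // y yd; rewrite distrC; apply: H.
move: yd; case: x {cf} => [[x1 x2] x3]; case: y => [[y1 y2] y3] yd.
by split; [split|]; rewrite -ball_normE/= distrC; [exact: (yd 0)|exact: (yd 1)|exact: (yd 2)].
Qed.

Lemma is_derive_C1_line f x k (t : R) : C1 f ->
  is_derive t 1 (fun t => f (x + t *: @basis3 R k)) (partial k f (x + t *: @basis3 R k)).
Proof. by move=> [_ /(_ k)[_ df]]; exact: is_derive_line. Qed.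

Lemma MVT_coord f x k (s : R) : C1 f -> exists2 u : R, `|u| <= `|s| &
  f (x + s *: @basis3 R k) - f x = s * partial k f (x + u *: @basis3 R k).
Proof.
move=> cf; have [u us] := MVT_abs s (fun t => is_derive_C1_line x k t cf).
by rewrite scale0r addr0 => e; exists u.
Qed.

(** The mean value theorem is used twice: along i for the difference of two translates of [f], then
    along j for [partial i f]. *)
Lemma second_difference f x i j (h : R) : C1 f -> C1 (partial i f) ->
  exists2 u : R, `|u| <= `|h| & exists2 w : R, `|w| <= `|h| &
  f (x + h *: @basis3 R i + h *: @basis3 R j) - f (x + h *: @basis3 R i)
   - f (x + h *: @basis3 R j) + f x =
  h ^+ 2 * partial j (partial i f) (x + u *: @basis3 R i + w *: @basis3 R j).
Proof.
move=> cf cif.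
have dg (t : R) : is_derive t 1 (fun t => f (x + h *: @basis3 R j + t *: @basis3 R i)
    - f (x + t *: @basis3 R i)) (partial i f (x + h *: @basis3 R j + t *: @basis3 R i)
    - partial i f (x + t *: @basis3 R i)).
  by apply: is_deriveB; exact: is_derive_C1_line.
have [u uh] := MVT_abs h dg.
rewrite !scale0r !addr0 => e; exists u => //.
have [w wh] := MVT_coord (x + u *: @basis3 R i) j h cif.
move=> e2; exists w => //.
rewrite expr2 -mulrA -e2.
rewrite [x + u *: _ + _]addrAC -e [x + h *: @basis3 R j + _]addrAC; ring.
Qed.

(** The second difference over a square of side h is symmetric in i and j, and equals h^2 times
    either mixed derivative at a point near x; continuity of both at x then forces equality. *)
Lemma schwarz f x i j : smooth f ->
  partial i (partial j f) x = partial j (partial i f) x.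
Proof.
move=> sf.
have c0 := smooth_C1 [::] sf.
have ci := smooth_C1 [:: i] sf; have cj := smooth_C1 [:: j] sf.
have cij : continuous (partial i (partial j f)) by have [] := sf [:: i; j].
have cji : continuous (partial j (partial i f)) by have [] := sf [:: j; i].
apply/eqP; rewrite -subr_eq0 -normr_le0; apply/ler_addgt0Pl => e e0; rewrite addr0.
have e2 : 0 < e / 2 by rewrite divr_gt0.
have [d1 d10 H1] := continuous_coords (cij x) e2.
have [d2 d20 H2] := continuous_coords (cji x) e2.
(* Each coordinate of an intermediate point moves by at most 2 h, half of the smaller radius. *)
pose h := Num.min d1 d2 / 4.
have m0 : 0 < Num.min d1 d2 by rewrite lt_min d10.
have h0 : 0 < h by rewrite divr_gt0.
have small a b (u w : R) k : `|u| <= `|h| -> `|w| <= `|h| ->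
    `|coord k (x + u *: @basis3 R a + w *: @basis3 R b) - coord k x| < Num.min d1 d2.
  rewrite (gtr0_norm h0) => uh wh; rewrite !coord_line.
  rewrite [X in `|X|](_ : _ = u * (k == a)%:R + w * (k == b)%:R); last by ring.
  have le1 (z : R) (bb : bool) : `|z| <= h -> `|z * bb%:R| <= h.
    by case: bb => zh; rewrite /= ?mulr1 ?mulr0 ?normr0 ?(ltW h0).
  rewrite (le_lt_trans (ler_normD _ _))// (le_lt_trans (lerD (le1 _ _ uh) (le1 _ _ wh)))//.
  by rewrite /h; lra.
have [u uh [w wh E1]] := @second_difference _ x i j h c0 ci.
have [u' uh' [w' wh' E2]] := @second_difference _ x j i h c0 cj.
have E : partial j (partial i f) (x + u *: @basis3 R i + w *: @basis3 R j) =
         partial i (partial j f) (x + u' *: @basis3 R j + w' *: @basis3 R i).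
  apply: (@mulfI _ (h ^+ 2)); first by rewrite expf_neq0// gt_eqF.
  by rewrite -E1 -E2 [x + h *: _ + _]addrAC; ring.
have B1 : `|partial i (partial j f) (x + u' *: @basis3 R j + w' *: @basis3 R i)
    - partial i (partial j f) x| < e / 2.
  by apply: H1 => k; rewrite (lt_le_trans (small _ _ _ _ _ uh' wh'))// ge_min lexx.
have B2 : `|partial j (partial i f) (x + u *: @basis3 R i + w *: @basis3 R j)
    - partial j (partial i f) x| < e / 2.
  by apply: H2 => k; rewrite (lt_le_trans (small _ _ _ _ _ uh wh))// ge_min lexx orbT.
rewrite E in B2; rewrite distrC in B1.
have := lerD (ltW B1) (ltW B2); rewrite -splitr; apply: le_trans.
exact: ler_distD.
Qed.

End smooth_functions.

(** * The chain rule along rays through the origin *)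

Section test_functions.
Context {R : realType}.
Notation R3 := (measurableTypeR R * measurableTypeR R * measurableTypeR R)%type.
Implicit Types (f : R * R * R -> R) (x y v : R * R * R) (i j k : 'I_3).

Lemma coordP x y : (forall i, coord i x = coord i y) -> x = y.
Proof.
move: x y => [[x1 x2] x3] [[y1 y2] y3] h.
by rewrite (h 0 : x1 = y1) (h 1 : x2 = y2) (h 2 : x3 = y3).
Qed.

(** The increment from t v to (t + h) v is split into three moves along the axes; the mean value
    theorem handles each, and continuity of the partial derivatives gives the limit. *)
Lemma is_derive_ray f v (t : R) : C1 f ->
  is_derive t 1 (fun t => f (t *: v)) (\sum_(j < 3) coord j v * partial j f (t *: v)).
Proof.
move=> cf; set L := \sum_(j < 3) _; set p := t *: v.
(* The summand 1 makes [S] positive even for v = 0, and makes the final estimate by e = S q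
   strict. *)
pose S : R := `|coord 0 v| + `|coord 1 v| + `|coord 2 v| + 1.
have S0 : 0 < S by rewrite ltr_wpDl ?addr_ge0.
suff H : (fun h : R => h^-1 *: (((fun t => f (t *: v)) \o shift t) (h *: 1) - f p))
    @ 0^' --> L.
  by split; [exact: cvgP H|exact: cvg_lim H].
apply/cvgrPdist_lt => e e0.
pose q := e / S; have e1 : 0 < q by rewrite divr_gt0.
have dk k : exists2 d : R, 0 < d & forall y, (forall i, `|coord i y - coord i p| < d) ->
    `|partial k f y - partial k f p| < q.
  by have [_ /(_ k)[ck _]] := cf; exact: continuous_coords (ck p) e1.
have [d0 d00 H0] := dk 0; have [d1 d10 H1] := dk 1; have [d2 d20 H2] := dk 2.
pose d := Num.min d0 (Num.min d1 d2).
have d_gt0 : 0 < d by rewrite !lt_min d00 d10.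
near=> h.
have h0 : h != 0 by near: h; exact: nbhs_dnbhs_neq.
have hd : `|h| < d / S.
  near: h; apply: dnbhs0_lt; exact: divr_gt0.
have hS : `|h| * S < d by rewrite -ltr_pdivlMr.
pose p1 := p + (h * coord 0 v) *: @basis3 R 0.
pose p2 := p1 + (h * coord 1 v) *: @basis3 R 1.
pose p3 := p2 + (h * coord 2 v) *: @basis3 R 2.
have -> : h^-1 *: (((fun t => f (t *: v)) \o shift t) (h *: 1) - f p) =
    h^-1 * (f p3 - f p).
  congr (_ * (f _ - _)); apply: coordP => i.
  rewrite /= -[h *: 1]/(h * 1) mulr1 !coord_line !coordZ.
  by elim/ord3_ind: i => /=; ring.
have [u0 hu0 E0] := MVT_coord p 0 (h * coord 0 v) cf.
have [u1 hu1 E1] := MVT_coord p1 1 (h * coord 1 v) cf.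
have [u2 hu2 E2] := MVT_coord p2 2 (h * coord 2 v) cf.
rewrite -/p1 in E0; rewrite -/p2 in E1; rewrite -/p3 in E2.
have -> : h^-1 * (f p3 - f p) =
    coord 0 v * partial 0 f (p + u0 *: @basis3 R 0) +
    coord 1 v * partial 1 f (p1 + u1 *: @basis3 R 1) +
    coord 2 v * partial 2 f (p2 + u2 *: @basis3 R 2).
  have -> : f p3 - f p = (f p3 - f p2) + (f p2 - f p1) + (f p1 - f p) by ring.
  by rewrite E0 E1 E2; field.
have vS k : `|h * coord k v| < d.
  rewrite normrM (le_lt_trans _ hS)// ler_wpM2l// /S.
  have := normr_ge0 (coord 0 v); have := normr_ge0 (coord 1 v).
  by have := normr_ge0 (coord 2 v); elim/ord3_ind: k; lra.
have small i (a0 a1 a2 : R) : `|a0| < d -> `|a1| < d -> `|a2| < d ->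
    `|a0 * (i == 0)%:R + a1 * (i == 1)%:R + a2 * (i == 2)%:R| < d.
  by elim/ord3_ind: i => /= *; rewrite !mulr0 !mulr1 ?addr0 ?add0r.
have z0 : `|0 : R| < d by rewrite normr0.
have B0 : `|partial 0 f (p + u0 *: @basis3 R 0) - partial 0 f p| < q.
  apply: H0 => i; rewrite (@lt_le_trans _ _ d)//; last by rewrite /d !ge_min lexx.
  have := small i _ _ _ (le_lt_trans hu0 (vS 0)) z0 z0.
  by rewrite !coord_line; congr (`|_| < _); ring.
have B1 : `|partial 1 f (p1 + u1 *: @basis3 R 1) - partial 1 f p| < q.
  apply: H1 => i; rewrite (@lt_le_trans _ _ d)//; last by rewrite /d !ge_min lexx ?orbT.
  have := small i _ _ _ (vS 0) (le_lt_trans hu1 (vS 1)) z0.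
  by rewrite !coord_line; congr (`|_| < _); ring.
have B2 : `|partial 2 f (p2 + u2 *: @basis3 R 2) - partial 2 f p| < q.
  apply: H2 => i; rewrite (@lt_le_trans _ _ d)//; last by rewrite /d !ge_min lexx ?orbT.
  have := small i _ _ _ (vS 0) (vS 1) (le_lt_trans hu2 (vS 2)).
  by rewrite !coord_line; congr (`|_| < _); ring.
rewrite /L sum3 -/p.
move: (partial 0 f (p + _)) (partial 1 f (p1 + _)) (partial 2 f (p2 + _)) B0 B1 B2.
move: (partial 0 f p) (partial 1 f p) (partial 2 f p) => a0 a1 a2 b0 b1 b2 B0 B1 B2.
rewrite [X in `|X|](_ : _ = coord 0 v * (a0 - b0) + coord 1 v * (a1 - b1) +
   coord 2 v * (a2 - b2)); last by ring.
rewrite (le_lt_trans (ler_normD _ _))// (le_lt_trans (lerD (ler_normD _ _) (lexx _)))//.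
rewrite !normrM !(distrC _ b0) !(distrC _ b1) !(distrC _ b2).
have -> : e = S * q by rewrite mulrC divfK// gt_eqF.
rewrite /S !mulrDl mul1r -[ltLHS]addr0; apply: ler_ltD => //.
by apply: lerD; [apply: lerD|]; apply: ler_wpM2l => //; exact: ltW.
Unshelve. all: by end_near. Qed.

End test_functions.

(** * Compact support and boundedness *)

Section compact_support.
Context {R : realType}.
Implicit Types (f : R * R * R -> R) (x : R * R * R).

Definition vanish_outside (M : R) f := forall x, M <= enorm x -> f x = 0.

Lemma enorm_le x : enorm x <= 3 * `|x|.
Proof.
have c (j : 'I_3) : `|coord j x| <= `|x|.
  case: x => [[a b] d]; elim/ord3_ind: j; rewrite /Num.norm/= !le_max.
  - by rewrite lexx.
  - by rewrite lexx orbT.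
  - by rewrite lexx orbT.
rewrite -(@ler_pXn2r _ 2) ?nnegrE ?enorm_ge0 ?mulr_ge0//.
rewrite enorm_sqr sum3.
have cc (j : 'I_3) : coord j x ^+ 2 <= `|x| ^+ 2.
  by rewrite -[leLHS]real_normK ?num_real// ler_pXn2r ?nnegrE.
have := cc 0; have := cc 1; have := cc 2; have := sqr_ge0 `|x|.
by rewrite exprMn; lra.
Qed.

(** The condition K < |x| is open, so [f] vanishes near each such point and the condition passes to
    derivatives of every order with the same K. *)
Lemma partial_vanish (K : R) k f : 0 <= K -> (forall x, K < enorm x -> f x = 0) ->
  forall x, K < enorm x -> partial k f x = 0.
Proof.
move=> K0 f0 x Kx; apply: derive_val; apply: derive_line0.
have x0 : x != 0 by rewrite -enorm_gt0 (le_lt_trans K0).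
apply: (near_eq_is_derive _ (is_derive_cst (0 : R) (0 : R) 1)).
have d : enorm (x + t *: @basis3 R k) @[t --> (0 : R)] -->
    enorm (x + 0 *: @basis3 R k).
  by apply: (is_derive_continuous (is_derive_enorm_line _)); rewrite scale0r addr0.
rewrite scale0r addr0 in d.
near=> t; apply/esym/f0; near: t.
exact: (cvgr_gt (enorm x) d).
Unshelve. all: by end_near. Qed.

Lemma test_function_vanish f : test_function f ->
  exists2 M : R, 0 < M & forall s, vanish_outside M (iter_partial s f).
Proof.
move=> [_ /compact_bounded[K [_ Kb]]].
have K1 := Kb (`|K| + 1) _.
pose N : R := 3 * (`|K| + 1).
have N0 : 0 <= N by rewrite mulr_ge0// addr_ge0.
have fN x : N < enorm x -> f x = 0.
  move=> Nx; apply: contraPeq Nx => fx0; apply/negP; rewrite -leNgt.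
  rewrite (le_trans (enorm_le x))// ler_pM2l//; apply: K1.
    by rewrite (le_lt_trans (ler_norm K))// ltrDl.
  exact: subset_closure.
(* One unit more turns the strict bound into the large one of [vanish_outside]. *)
exists (N + 1); first by rewrite ltr_wpDl.
suff H s x : N < enorm x -> iter_partial s f x = 0.
  by move=> s x Nx; apply: H; rewrite (lt_le_trans _ Nx)// ltrDl.
by elim: s x => [|k s IH] x /= Nx; [exact: fN|exact: (@partial_vanish N k (iter_partial s f) N0 IH x Nx)].
Qed.

Lemma continuous_vanish_bounded f (M : R) : continuous f -> vanish_outside M f ->
  exists2 C : R, 0 <= C & forall x, `|f x| <= C.
Proof.
move=> cf fM.
have cpt : compact (`[- M, M]%classic `*` `[- M, M]%classic `*` `[- M, M]%classic).
  by apply: compact_setX; [apply: compact_setX|]; exact: segment_compact.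
have /compact_bounded[K [_ Kb]] := continuous_compact (continuous_subspaceT cf) cpt.
exists (`|K| + 1) => [|x]; first by rewrite addr_ge0.
have [Mx|xM] := leP M (enorm x); first by rewrite fM// normr0 addr_ge0.
apply: (Kb (`|K| + 1)); first by rewrite (le_lt_trans (ler_norm K))// ltrDl.
exists x => //.
have c j : - M <= coord j x <= M.
  by rewrite -ler_norml (le_trans (coord_le_enorm j x))// ltW.
by case: x c {xM} => [[a b] d] c; split; [split|]; rewrite /= in_itv/=;
  [exact: (c 0)|exact: (c 1)|exact: (c 2)].
Qed.

End compact_support.

(** * Integration by parts and radial flux *)

Section integration_by_parts.
Context {R : realType}.
Notation R3 := (measurableTypeR R * measurableTypeR R * measurableTypeR R)%type.
Variables (c M : R).
Hypotheses (c1 : 1 < `|c|) (M0 : 0 < M).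
Implicit Types (f : R * R * R -> R) (x : R * R * R) (i j k : 'I_3) (s : aexp R).

Definition C1_in_ball f := [/\ C1 f, vanish_outside M f &
  forall k, vanish_outside M (partial k f)].

Lemma enormV_le x : enorm x < M -> (enorm x)^-1 <= M * (enorm x ^+ 2)^-1.
Proof.
move=> xM; have [->|r0] := eqVneq (enorm x) 0; first by rewrite expr0n invr0 mulr0.
have r1 : 0 < enorm x by rewrite lt0r r0 enorm_ge0.
rewrite expr2 invfM mulrA ler_peMl ?invr_ge0 ?enorm_ge0//.
by rewrite ler_pdivlMr// mul1r ltW.
Qed.

Lemma integrable_degree2 s f : continuous f -> vanish_outside M f ->
  (@lebesgue3 R).-integrable [set: R * R * R]
    (EFin \o (fun x => aval c s x / enorm x ^+ 2 * f x)).
Proof.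
move=> cf fM.
have [C C0 hC] := aval_bounded c1 s.
have [B B0 hB] := continuous_vanish_bounded cf fM.
apply: (@integrable_enormV2 _ _ (C * B) M) => //.
- apply: measurable_funM; last exact: continuous_measurable3.
  apply: measurable_funM; first exact: measurable_aval.
  apply: (measurableT_comp measurable_inv); apply: measurable_funX.
  exact: measurable_enorm.
- by move=> x Mx; rewrite fM// mulr0.
- move=> x; rewrite !normrM normfV (ger0_norm (sqr_ge0 _)) mulrAC.
  by rewrite ler_wpM2r ?invr_ge0 ?sqr_ge0// ler_pM.
Qed.

Lemma integrable_degree1 s f : continuous f -> vanish_outside M f ->
  (@lebesgue3 R).-integrable [set: R * R * R]
    (EFin \o (fun x => aval c s x / enorm x * f x)).
Proof.
move=> cf fM.
have [C C0 hC] := aval_bounded c1 s.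
have [B B0 hB] := continuous_vanish_bounded cf fM.
apply: (@integrable_enormV2 _ _ (C * B * M) M) => //.
- apply: measurable_funM; last exact: continuous_measurable3.
  apply: measurable_funM; first exact: measurable_aval.
  by apply: (measurableT_comp measurable_inv); exact: measurable_enorm.
- by move=> x Mx; rewrite fM// mulr0.
- move=> x; have [Mx|xM] := leP M (enorm x).
    by rewrite fM// mulr0 normr0 !mulr_ge0 ?invr_ge0 ?sqr_ge0// ltW.
  rewrite !normrM normfV (ger0_norm (enorm_ge0 _)) mulrAC -[leRHS]mulrA.
  by rewrite ler_pM ?mulr_ge0 ?invr_ge0 ?enorm_ge0 ?enormV_le// ler_pM.
Qed.

(** On every line missing the origin the integrand is the derivative of the compactly supported
    product of s/|x| and [f]. Both terms are integrable, so almost all lines suffice and the origin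
    contributes nothing. *)
Lemma integration_by_parts3 s i f : C1_in_ball f ->
  has_integral (@lebesgue3 R) (fun x => aval c (agrad i s) x / enorm x ^+ 2 * f x +
    aval c s x / enorm x * partial i f x) 0.
Proof.
move=> fB; have [[cf df] fM dfM] := fB; have [cdf _] := df i.
set h := fun x => _.
have hi : (@lebesgue3 R).-integrable [set: R * R * R] (EFin \o h).
  exact: (integrableD measurableT (integrable_degree2 (agrad i s) cf fM)
    (integrable_degree1 s cdf (dfM i))).
split=> //; apply: (integral_lines_eq0 (i := i)) => // x x0.
have cl : continuous (fun t : R => x + t *: @basis3 R i).
  by move=> t; apply: cvgD; [exact: cvg_cst|exact: scalel_continuous].
pose F (t : R) := aval c s (x + t *: @basis3 R i) / enorm (x + t *: @basis3 R i) *
  f (x + t *: @basis3 R i).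
have dF (t : R) : is_derive t 1 F (h (x + t *: @basis3 R i)).
  apply: (is_derive_eq (is_deriveM (is_derive_aval_enormV_line c1 s (x0 t))
    (is_derive_C1_line x i t (conj cf df)))).
  by rewrite /h /GRing.scale/=; ring.
have far (t : R) : M + `|coord i x| <= `|t| -> M <= enorm (x + t *: @basis3 R i).
  move=> Mt; apply: le_trans (coord_le_enorm i _).
  rewrite coord_line eqxx mulr1 addrC.
  by rewrite (le_trans _ (lerB_normD _ _))// lerBrDr.
suff [] : has_integral lebesgue_measure (fun t => h (x + t *: @basis3 R i)) 0 by [].
apply: (@has_integral_compact_derive R F _ (M + `|coord i x|)).
- by rewrite ltr_pwDl.
- move=> t.
  have d1 := is_deriveM (is_derive_aval_enormV_line c1 (agrad i s) (x0 t))
    (is_derive_enormV_line (x0 t)).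
  have d2 := is_derive_aval_enormV_line c1 s (x0 t).
  (* Splitting |x|^-2 into two inverses exhibits factors already known to be differentiable, hence
     continuous. *)
  have -> : (fun t => h (x + t *: @basis3 R i)) = (fun t =>
      aval c (agrad i s) (x + t *: @basis3 R i) / enorm (x + t *: @basis3 R i) *
      (enorm (x + t *: @basis3 R i))^-1 * f (x + t *: @basis3 R i) +
      aval c s (x + t *: @basis3 R i) / enorm (x + t *: @basis3 R i) *
      partial i f (x + t *: @basis3 R i)).
    by apply/funext => u; rewrite /h expr2 invfM mulrA.
  apply: cvgD; apply: cvgM.
  + exact: (is_derive_continuous d1).
  + by apply: (@continuous_comp _ _ _ (fun t : R => x + t *: @basis3 R i) f);
      [exact: cl|exact: cf].
  + exact: (is_derive_continuous d2).
  + by apply: (@continuous_comp _ _ _ (fun t : R => x + t *: @basis3 R i) (partial i f));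
      [exact: cl|exact: cdf].
- by move=> t /far tM; rewrite /F fM// mulr0.
- by move=> t /far tM; rewrite /h fM// dfM// !mulr0 addr0.
Qed.

End integration_by_parts.

(** * Flux of a radial field of degree -2 through the unit sphere *)

Section radial_flux.
Context {R : realType}.
Notation mu := (@lebesgue_measure R).
Notation R3 := (measurableTypeR R * measurableTypeR R * measurableTypeR R)%type.
Variables (c M : R).
Hypotheses (c1 : 1 < `|c|) (M0 : 0 < M).
Implicit Types (f : R * R * R -> R) (x v : R * R * R) (i j k : 'I_3) (g : aexp R).

Lemma enorm_axis_ge1 (a w : R) : 1 <= enorm ((a, 1), w).
Proof. by have := coord_le_enorm 1 ((a, 1), w); rewrite normr1. Qed.

(** Homogeneity holds for positive factors only: for y < 0 the point y v is (- y)(- v), so [g] is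
    evaluated at - v and the direction cosines change sign. *)
Lemma ray_integrandE g f v (y : R) : y != 0 -> v != 0 ->
  y ^+ 2 * (aval c g (y *: v) / enorm (y *: v) ^+ 2 *
    \sum_(j < 3) dir j (y *: v) * partial j f (y *: v)) =
  (if 0 < y then aval c g v / enorm v ^+ 3 else - (aval c g (- v) / enorm v ^+ 3)) *
    \sum_(j < 3) coord j v * partial j f (y *: v).
Proof.
move=> y0; rewrite -enorm_gt0 => /lt0r_neq0 v0.
have [yp|yn] := ltP 0 y.
  rewrite avalZ// enormZ gtr0_norm// !sum3 !dirZ// /dir.
  move: (partial 0 f _) (partial 1 f _) (partial 2 f _) => p0 p1 p2.
  move: (coord 0 v) (coord 1 v) (coord 2 v) (aval c g v) (enorm v) v0 => ? ? ? ? n n0.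
  by field; rewrite n0 y0.
have yn' : 0 < - y by rewrite oppr_gt0 lt_neqAle y0.
have nv : enorm (- v) = enorm v by rewrite -scaleN1r enormZ normrN1 mul1r.
have cv j : coord j (- v) = - coord j v by rewrite -scaleN1r coordZ mulN1r.
rewrite -[y *: v]opprK -scaleNr -scalerN avalZ// enormZ gtr0_norm// nv !sum3 !dirZ//.
rewrite /dir nv !cv scalerN scaleNr opprK.
move: (partial 0 f _) (partial 1 f _) (partial 2 f _) => p0 p1 p2.
move: (coord 0 v) (coord 1 v) (coord 2 v) (aval c g (- v)) (enorm v) v0 => ? ? ? ? n n0.
by field; rewrite n0 y0.
Qed.

(** Along the line through v the integrand is a two-valued step function times the derivative of y
    -> f (y v), so only the jump at y = 0 survives. *)
Lemma integral_ray g f (a w : R) : C1_in_ball M f ->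
  measurable_fun setT (fun y : R => y ^+ 2 *
    (aval c g (y *: ((a, 1), w)) / enorm (y *: ((a, 1), w)) ^+ 2 *
    \sum_(j < 3) dir j (y *: ((a, 1), w)) * partial j f (y *: ((a, 1), w)))) ->
  (\int[mu]_y (y ^+ 2 *
    (aval c g (y *: ((a, 1%R), w)) / enorm (y *: ((a, 1%R), w)) ^+ 2 *
    \sum_(j < 3) dir j (y *: ((a, 1%R), w)) * partial j f (y *: ((a, 1%R), w))))%:E =
  (- f 0 * ((aval c g ((a, 1%R), w) + aval c g (- ((a, 1%R), w))) /
    enorm ((a, 1%R), w) ^+ 3))%:E)%E.
Proof.
move=> [[cf df] fM dfM] mh; set v := ((a, 1), w) in mh *.
have n1 : 1 <= enorm v := enorm_axis_ge1 a w.
have v0 : v != 0 by rewrite -enorm_gt0 (lt_le_trans ltr01).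
have far (y : R) : M <= `|y| -> M <= enorm (y *: v).
  by move=> yM; rewrite enormZ (le_trans yM)// ler_peMr.
have cl : continuous (fun y : R => y *: v) by exact: scalel_continuous.
have cdf : continuous (fun y : R => \sum_(j < 3) coord j v * partial j f (y *: v)).
  rewrite (_ : (fun _ => _) = (fun y => coord 0 v * partial 0 f (y *: v) +
    coord 1 v * partial 1 f (y *: v) + coord 2 v * partial 2 f (y *: v))); last first.
    by apply/funext => y; rewrite sum3.
  have cj j : continuous (fun y : R => coord j v * partial j f (y *: v)).
    move=> y; apply: cvgM; first exact: cvg_cst.
    have [cp _] := df j.
    by apply: (@continuous_comp _ _ _ (fun y : R => y *: v)); [exact: cl|exact: cp].
  by move=> y; apply: cvgD; [apply: cvgD|]; exact: cj.
have far0 (y : R) : M <= `|y| -> \sum_(j < 3) coord j v * partial j f (y *: v) = 0.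
  by move=> /far yM; rewrite big1// => j _; rewrite dfM// mulr0.
have [hi hv] := @has_integral_two_sided R (fun y => f (y *: v)) _ M
  (aval c g v / enorm v ^+ 3) (- (aval c g (- v) / enorm v ^+ 3)) M0 cdf
  (fun y => is_derive_ray v y (conj cf df)) (fun y yM => fM _ (far y yM))
  far0.
transitivity (((- (aval c g (- v) / enorm v ^+ 3) - aval c g v / enorm v ^+ 3) *
    f (0 *: v))%:E); last first.
  rewrite scale0r; congr (_%:E).
  have n0 : enorm v != 0 by rewrite gt_eqF//; exact: lt_le_trans ltr01 n1.
  by move: (enorm v) n0 (f 0) (aval c g v) (aval c g (- v)) => n n0 ? ? ?; field.
rewrite -hv; apply: ae_eq_integral => //.
- exact/measurable_EFinP.
- exact: measurable_int hi.
- exists [set 0]; split => //; first exact: lebesgue_measure_set1.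
  move=> y /= yN; apply: contrapT => /eqP y0; apply: yN => _.
  by rewrite ray_integrandE.
Qed.

(** In the chart v = (a, 1, w) the area element of the sphere is da dw / |v|^3, and v and - v cover
    both hemispheres. Since 1/(1 + w^2) has integral pi, [kappa * pi] is the integral of [g] over
    the unit sphere. *)
Lemma radial_flux g (kappa : R) f : C1_in_ball M f ->
  (forall w : R, has_integral mu (fun a : R =>
    (aval c g ((a, 1), w) + aval c g (- ((a, 1), w))) / enorm ((a, 1), w) ^+ 3)
    (kappa / (1 + w ^+ 2))) ->
  has_integral (@lebesgue3 R) (fun x => aval c g x / enorm x ^+ 2 *
    \sum_(j < 3) dir j x * partial j f x) (- f 0 * (kappa * pi)).
Proof.
move=> fB hg; have [[cf df] fM dfM] := fB.
set h := fun x => _.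
have hi : (@lebesgue3 R).-integrable [set: R * R * R] (EFin \o h).
  have I j : (@lebesgue3 R).-integrable [set: R * R * R] (EFin \o
      (fun x => aval c (AMul g (ADir j)) x / enorm x ^+ 2 * partial j f x)).
    by have [cp _] := df j; exact: (integrable_degree2 c1 M0 _ cp (dfM j)).
  have := integrableD measurableT (integrableD measurableT (I 0) (I 1)) (I 2).
  apply: eq_integrable => // x _ /=; rewrite /h sum3 -!EFinD; congr (_%:E).
  move: (partial 0 f x) (partial 1 f x) (partial 2 f x) => p0 p1 p2.
  by move: (dir 0 x) (dir 1 x) (dir 2 x) ((enorm x ^+ 2)^-1) => *; ring.
apply: has_integral_ray_point => //.
have Hi := integrable_ray_point hi.
split => //.
pose v (a w : R) : R * R * R := ((a, 1), w).
pose l1 (a w : R) := - f 0 * ((aval c g (v a w) + aval c g (- v a w)) / enorm (v a w) ^+ 3).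
pose l2 (w : R) := - f 0 * kappa * (1 + w ^+ 2)^-1.
have [il2 el2] := has_integralZ (- f 0 * kappa) (@has_integral_oneDsqrV R).
rewrite (@integral_iterated R _ l1 l2)//.
- by rewrite el2 mulrA.
- by apply/measurable_EFinP; exact: measurable_int il2.
- move=> a w _.
  have mh : measurable_fun setT (fun y : R => y ^+ 2 * h (y *: v a w)).
    have mv : measurable_fun [set: R] (fun y : measurableTypeR R =>
        ((y, a), w) : measurableTypeR R * measurableTypeR R * measurableTypeR R).
      by apply: measurable_fun_pair => //; exact: measurable_fun_pair.
    have := measurableT_comp (measurable_int _ Hi) mv.
    move=> /measurable_EFinP; apply: eq_measurable_fun => y _.
    by rewrite /= ray_pointE.
  apply: eq_trans (@integral_ray g f a w fB mh).
  by apply: eq_integral => y _; rewrite ray_pointE.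
- move=> w _; have [_ ->] := has_integralZ (- f 0) (hg w).
  by rewrite /l2 mulrA.
Qed.

End radial_flux.

(** * The Landau solution *)

Section landau_angular.
Context {R : realType}.
Variable c : R.
Hypothesis c1 : 1 < `|c|.
Implicit Types (x : R * R * R) (i j k : 'I_3).

Definition angular_p : aexp R :=
  AMul (ACst 4) (AMul (AAdd (AMul (ACst c) (ADir 0)) (ACst (-1))) (AMul ARes ARes)).

(** Encodes u = 2 e_1 / (c |x| - x_1) + p x / 2, multiplied by |x|. *)
Definition angular_u k : aexp R :=
  AAdd (AMul (ACst (2 * (k == 0)%:R)) ARes) (AMul (ACst 2^-1) (AMul (ADir k) angular_p)).

(* |x|^2 times the radial component of the momentum flux
   grad u_k - u_k u - p e_k, written g_k above *)
Definition radial_part k : aexp R :=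
  AMul (ACst (-1)) (AAdd (angular_u k) (AAdd
    (AMul (angular_u k) (AAdd (AMul (angular_u 0) (ADir 0))
      (AAdd (AMul (angular_u 1) (ADir 1)) (AMul (angular_u 2) (ADir 2)))))
    (AMul angular_p (ADir k)))).

(* |x| times the vector potential of the tangential component, namely
   -2 ((e_1 x e_(k+1)) . x) x / (|x|^2 (c |x| - x_1)) *)
Definition potential k j : aexp R :=
  AMul (AMul (ACst (-2)) ARes)
    (AMul (AAdd (AMul (ACst (k == 1)%:R) (ADir 2)) (AMul (ACst (- (k == 2)%:R)) (ADir 1)))
      (ADir j)).

Lemma landau_uE k x : x != 0 -> landau_u c k x = aval c (angular_u k) x / enorm x.
Proof.
move=> x0; have s0 := sub_dir_neq0 c1 x.
have r0 : enorm x != 0 by rewrite gt_eqF// enorm_gt0.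
have D0 : c * enorm x - coord 0 x != 0.
  apply: contra_neq s0 => /eqP; rewrite subr_eq0 => /eqP D.
  by rewrite /dir -D mulfK// subrr.
move: s0; rewrite /= /dir; elim/ord3_ind: k => /= s0.
- rewrite -[LHS]/(2 * ((c * enorm x ^+ 2 - 2 * coord 0 x * enorm x + c * coord 0 x ^+ 2) /
    (enorm x * (c * enorm x - coord 0 x) ^+ 2))).
  move: (enorm x) (coord 0 x) r0 D0 s0 => r y r0 D0 s0.
  by field; rewrite r0 D0.
- rewrite -[LHS]/(2 * ((coord 1 x * (c * coord 0 x - enorm x)) /
    (enorm x * (c * enorm x - coord 0 x) ^+ 2))).
  move: (enorm x) (coord 0 x) (coord 1 x) r0 D0 s0 => r y z r0 D0 s0.
  by field; rewrite r0 D0.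
- rewrite -[LHS]/(2 * ((coord 2 x * (c * coord 0 x - enorm x)) /
    (enorm x * (c * enorm x - coord 0 x) ^+ 2))).
  move: (enorm x) (coord 0 x) (coord 2 x) r0 D0 s0 => r y z r0 D0 s0.
  by field; rewrite r0 D0.
Qed.

Lemma landau_pE x : x != 0 -> landau_p c x = aval c angular_p x / enorm x ^+ 2.
Proof.
move=> x0; have s0 := sub_dir_neq0 c1 x.
have r0 : enorm x != 0 by rewrite gt_eqF// enorm_gt0.
have D0 : c * enorm x - coord 0 x != 0.
  apply: contra_neq s0 => /eqP; rewrite subr_eq0 => /eqP D.
  by rewrite /dir -D mulfK// subrr.
move: s0; rewrite /= /dir => s0.
rewrite -[LHS]/(4 * ((c * coord 0 x - enorm x) /
    (enorm x * (c * enorm x - coord 0 x) ^+ 2))).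
move: (enorm x) (coord 0 x) r0 D0 s0 => r y r0 D0 s0.
by field; rewrite r0 D0.
Qed.

Lemma partial_landau_u k j x : x != 0 ->
  partial j (landau_u c k) x = aval c (agrad j (angular_u k)) x / enorm x ^+ 2.
Proof.
move=> x0; apply: derive_val; apply: derive_line0.
have x00 : x + 0 *: @basis3 R j != 0 by rewrite scale0r addr0.
have := is_derive_aval_enormV_line c1 (angular_u k) x00.
rewrite /= scale0r addr0; apply: near_eq_is_derive.
have d : enorm (x + t *: @basis3 R j) @[t --> (0 : R)] --> enorm (x + 0 *: @basis3 R j).
  exact: (is_derive_continuous (is_derive_enorm_line x00)).
rewrite scale0r addr0 in d.
near=> t; apply/esym/landau_uE; rewrite -enorm_gt0; near: t.
by apply: (cvgr_gt (enorm x) d); rewrite enorm_gt0.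
Unshelve. all: by end_near. Qed.

Lemma div_angular_u x : x != 0 ->
  aval c (agrad 0 (angular_u 0)) x + aval c (agrad 1 (angular_u 1)) x +
  aval c (agrad 2 (angular_u 2)) x = 0.
Proof.
move=> x0; have s0 := sub_dir_neq0 c1 x.
have := sum_dir_sqr x0; rewrite sum3 /=.
move: (dir 0 x) (dir 1 x) (dir 2 x) s0 => t a b s0 h.
have hb : b ^+ 2 = 1 - t ^+ 2 - a ^+ 2 by rewrite -h; ring.
(* Once e = (c - t)^-1 is an independent symbol, this relation and the equation of the sphere reduce
   the claim to a polynomial identity. *)
have hc : c * (c - t)^-1 = 1 + t * (c - t)^-1 by field.
move: ((c - t)^-1) hc => e hc.
by field: hb hc.
Qed.

(** Radial part plus curl of the potential, paired with an arbitrary vector that later becomes the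
    gradient of the test function. For k = 0 the potential is 0 and the flux is purely radial. *)
Lemma momentum_flux k x (p0 p1 p2 : R) : x != 0 ->
  let G j := aval c (agrad j (angular_u k)) x
    - aval c (angular_u k) x * aval c (angular_u j) x
    - aval c angular_p x * (k == j)%:R in
  let dA i j := aval c (agrad i (potential k j)) x in
  G 0 * p0 + G 1 * p1 + G 2 * p2 =
  aval c (radial_part k) x * (dir 0 x * p0 + dir 1 x * p1 + dir 2 x * p2)
  + (dA 2 0 * p1 - dA 1 0 * p2) + (dA 0 1 * p2 - dA 2 1 * p0)
  + (dA 1 2 * p0 - dA 0 2 * p1).
Proof.
move=> x0; have s0 := sub_dir_neq0 c1 x.
have := sum_dir_sqr x0; rewrite sum3 /= => h.
have hb : dir 2 x ^+ 2 = 1 - dir 0 x ^+ 2 - dir 1 x ^+ 2 by rewrite -h; ring.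
have hc : c * (c - dir 0 x)^-1 = 1 + dir 0 x * (c - dir 0 x)^-1 by field.
elim/ord3_ind: k => /=;
  move: (dir 0 x) (dir 1 x) (dir 2 x) hb ((c - dir 0 x)^-1) hc => t a b hb e hc;
  by field: hb hc.
Qed.

(** Partial fraction form in e = 1/(c - t), with t eliminated, so that it can be integrated term by
    term. *)
Definition radial1 (t : R) : R :=
  let e := (c - t)^-1 in let q := c ^+ 2 - 1 in
  - 4 * c * q ^+ 2 * e ^+ 4 + 8 * q ^+ 2 * e ^+ 3 - 6 * c * q * e ^+ 2
  + 4 * c ^+ 2 * e - 2 * c.

(** Left unexpanded: only its dependence on t = x_1/|x| alone matters for the symmetry argument. *)
Definition radial23 (t : R) : R :=
  let e := (c - t)^-1 in let P := 4 * ((c * t - 1) * e ^+ 2) in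
  - (P / 2) - P / 2 * (2 * e * t + P / 2) - P.

Lemma radial_part1E x : x != 0 -> aval c (radial_part 0) x = radial1 (dir 0 x).
Proof.
move=> x0; have s0 := sub_dir_neq0 c1 x.
have := sum_dir_sqr x0; rewrite sum3 /radial1 /= => h.
have hb : dir 2 x ^+ 2 = 1 - dir 0 x ^+ 2 - dir 1 x ^+ 2 by rewrite -h; ring.
have hc : c * (c - dir 0 x)^-1 = 1 + dir 0 x * (c - dir 0 x)^-1 by field.
move: (dir 0 x) (dir 1 x) (dir 2 x) hb ((c - dir 0 x)^-1) hc => t a b hb e hc.
by field: hb hc.
Qed.

Lemma radial_part23E k x : k != 0 -> x != 0 ->
  aval c (radial_part k) x = dir k x * radial23 (dir 0 x).
Proof.
move=> k0 x0; have s0 := sub_dir_neq0 c1 x.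
have := sum_dir_sqr x0; rewrite sum3 /radial23 /= => h.
have hb : dir 2 x ^+ 2 = 1 - dir 0 x ^+ 2 - dir 1 x ^+ 2 by rewrite -h; ring.
have hc : c * (c - dir 0 x)^-1 = 1 + dir 0 x * (c - dir 0 x)^-1 by field.
elim/ord3_ind: k k0 => //= _;
  move: (dir 0 x) (dir 1 x) (dir 2 x) hb ((c - dir 0 x)^-1) hc => t a b hb e hc;
  by field: hb hc.
Qed.

End landau_angular.

Lemma has_integral_odd (R : realType) (f : R -> R) :
  (@lebesgue_measure R).-integrable setT (EFin \o f) -> (forall x, f (- x) = - f x) ->
  has_integral (@lebesgue_measure R) f 0.
Proof.
move=> fi fo; split => //.
have mf := measurable_int _ fi.
have fp := integrable_fin_num measurableT (integrable_funepos measurableT fi).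
rewrite integralE [X in (_ - X)%E](_ : _ =
    \int[@lebesgue_measure R]_x ((EFin \o f)^\+ x))%E ?subee//.
rewrite ge0_integral_opp//; last exact: measurable_funepos.
by apply: eq_integral => x _; rewrite funenegE funeposE /= fo.
Qed.

(** * The flux integrals of the radial parts *)

Section landau_flux.
Context {R : realType}.
Notation mu := (@lebesgue_measure R).
Variable c : R.
Hypothesis c1 : 1 < `|c|.
Implicit Types (x : R * R * R) (i j k : 'I_3).

Let k0 (w : R) : 0 < 1 + w ^+ 2.
Proof. by rewrite ltr_pwDl ?sqr_ge0. Qed.

Lemma axis_neq0 (a w : R) : ((a, 1), w) != 0 :> R * R * R.
Proof. by apply/eqP => -[_ /eqP]; rewrite oner_eq0. Qed.

Lemma dir_axis0 (a w : R) : dir 0 ((a, 1), w) = slope (1 + w ^+ 2) a.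
Proof. by rewrite /dir enorm_axis. Qed.

Lemma dirN j x : dir j (- x) = - dir j x.
Proof.
by rewrite /dir -scaleN1r coordZ enormZ normrN1 mul1r mulN1r mulNr.
Qed.

(** The logarithm is taken of 1 - t/c rather than c - t, which would be negative for c < -1. *)
Definition radial1_primitive (t : R) : R :=
  let e := (c - t)^-1 in let q := c ^+ 2 - 1 in
  - (4 / 3) * c * q ^+ 2 * e ^+ 3 + 4 * q ^+ 2 * e ^+ 2 - 6 * c * q * e
  - 4 * c ^+ 2 * ln (1 - t / c) - 2 * c * t.

Lemma c_neq0 : c != 0.
Proof. by rewrite -normr_gt0 (lt_trans ltr01). Qed.

Lemma ratio_gt0 (t : R) : `|t| <= 1 -> 0 < 1 - t / c.
Proof.
move=> t1; rewrite subr_gt0 (le_lt_trans (ler_norm _))//.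
by rewrite normrM normfV ltr_pdivrMr ?normr_gt0 ?c_neq0// mul1r (le_lt_trans t1).
Qed.

Lemma sub_neq0 (t : R) : `|t| <= 1 -> c - t != 0.
Proof.
move=> t1; have := ratio_gt0 t1; apply: contraTneq => ct.
by rewrite (_ : t = c) ?divff ?c_neq0 ?subrr ?ltxx//; apply/eqP; rewrite eq_sym -subr_eq0 ct.
Qed.

Lemma is_derive_sub_inv (t : R) : `|t| <= 1 ->
  is_derive t 1 (fun t : R => (c - t)^-1) ((c - t) ^- 2).
Proof.
move=> t1; have d := is_deriveB (is_derive_cst c t 1) (is_derive_id t 1).
apply: (is_derive_eq (@is_deriveV _ (fun t => c - t) _ _ _ (sub_neq0 t1) d)).
by rewrite /GRing.scale/=; ring.
Qed.

Lemma is_derive_radial1_primitive (t : R) : `|t| <= 1 ->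
  is_derive t 1 radial1_primitive (radial1 c t).
Proof.
move=> t1; have de := is_derive_sub_inv t1.
have d := is_deriveB (is_derive_cst (1 : R) t 1)
  (is_deriveM (is_derive_id t 1) (is_derive_cst (c^-1 : R) t 1)).
have dl := @is_derive1_comp R (@ln R) (fun t => 1 - t / c) t _ _
  (is_derive1_ln (ratio_gt0 t1)) d.
rewrite /radial1_primitive.
have st := sub_neq0 t1; have rt := lt0r_neq0 (ratio_gt0 t1).
apply: is_derive_eq.
rewrite /GRing.scale/= /radial1; field.
by rewrite st c_neq0.
Qed.

Lemma continuous_radial1 (t : R) : `|t| <= 1 -> {for t, continuous (radial1 c)}.
Proof.
move=> t1; have de := is_derive_sub_inv t1.
rewrite /radial1.
apply: differentiable_continuous; apply/derivable1_diffP; apply: ex_derive.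
Qed.

Lemma radial1_flux (w : R) : has_integral mu (fun a : R =>
    (aval c (radial_part c 0) ((a, 1), w) + aval c (radial_part c 0) (- ((a, 1), w))) /
     enorm ((a, 1), w) ^+ 3)
    (2 * (radial1_primitive 1 - radial1_primitive (- 1)) / (1 + w ^+ 2)).
Proof.
have [C hC] : exists C : R, forall t : R, `|t| <= 1 -> `|radial1 c t| <= C.
  have /compact_bounded[K [_ Kb]] : compact (radial1 c @` `[- 1, 1]%classic).
    apply: continuous_compact; last exact: segment_compact.
    apply: continuous_in_subspaceT => t; rewrite inE /= in_itv/= -ler_norml.
    exact: continuous_radial1.
  exists (`|K| + 1) => t t1; apply: Kb.
    by rewrite (le_lt_trans (ler_norm K))// ltrDl.
  by exists t => //; rewrite /= in_itv/= -ler_norml.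
have := @has_integral_slope R _ (k0 w) _ _ _
  is_derive_radial1_primitive continuous_radial1 hC.
apply: has_integral_eq => a; rewrite enorm_axis.
have v0 := axis_neq0 a w.
by rewrite !radial_part1E ?oppr_eq0// dirN dir_axis0.
Qed.

(** Under a -> - a the k-th cosine is unchanged while x_1/|x| changes sign, so the sum over v and -
    v is odd in a. *)
Lemma radial23_flux k (w : R) : k != 0 -> has_integral mu (fun a : R =>
    (aval c (radial_part c k) ((a, 1), w) + aval c (radial_part c k) (- ((a, 1), w))) /
     enorm ((a, 1), w) ^+ 3) 0.
Proof.
move=> kn0; set f := fun a => _.
have [C C0 hC] := aval_bounded c1 (radial_part c k).
have [hi _] := has_integralZ (2 * C) (has_integral_hypV3 (k0 w)).
apply: has_integral_odd => [|a].
  apply: le_integrable hi => //.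
    apply/measurable_EFinP.
    have mv : measurable_fun [set: R] (fun a : measurableTypeR R =>
        ((a, 1), w) : measurableTypeR R * measurableTypeR R * measurableTypeR R).
      by apply: measurable_fun_pair => //; exact: measurable_fun_pair.
    have mN : measurable_fun [set: R] (fun a : measurableTypeR R =>
        ((- a, - 1), - w) : measurableTypeR R * measurableTypeR R * measurableTypeR R).
      by apply: measurable_fun_pair => //; exact: measurable_fun_pair.
    have mg := measurable_aval c (radial_part c k).
    apply: measurable_funM; last first.
      apply: (measurableT_comp measurable_inv); apply: measurable_funX.
      exact: (measurableT_comp measurable_enorm mv).
    exact: (measurable_funD (measurableT_comp mg mv) (measurableT_comp mg mN)).
  move=> a _; rewrite /= lee_fin /f normrM normfV enorm_axis.
  rewrite (ger0_norm (exprn_ge0 _ (ltW (hyp_gt0 (k0 w) a)))).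
  apply: le_trans (ler_norm _).
  rewrite ler_wpM2r ?invr_ge0 ?exprn_ge0 ?(ltW (hyp_gt0 _ _))//.
  rewrite (le_trans (ler_normD _ _))// mulr_natl mulr2n; exact: lerD.
have v0 b := axis_neq0 b w.
rewrite /f !radial_part23E ?oppr_eq0// !dirN !dir_axis0 !enorm_axis hypN slopeN opprK.
have -> : dir k ((- a, 1), w) = dir k ((a, 1), w).
  by elim/ord3_ind: k kn0 {f hC C C0 hi} => //= _; rewrite /dir !enorm_axis hypN.
move: (radial23 c _) (radial23 c _) (dir k _) ((hyp _ _ ^+ 3)^-1) => *.
ring.
Qed.

(** The left side is the flux through the unit sphere: by Archimedes, a function of x_1/|x|
    integrates to 2 pi times its integral over [-1, 1]. *)
Lemma radial1_primitive_landau_b :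
  2 * (radial1_primitive 1 - radial1_primitive (- 1)) * pi = - landau_b c.
Proof.
rewrite /landau_b /radial1_primitive.
have h1 : `|1 : R| <= 1 by rewrite normr1.
have hN1 : `|- 1 : R| <= 1 by rewrite normrN normr1.
have r1 := ratio_gt0 h1; have rN1 := ratio_gt0 hN1.
have s1 := sub_neq0 h1; have sN1 := sub_neq0 hN1.
(* Numerator and denominator are now positive for either sign of c, so the logarithm splits. *)
rewrite (_ : (c - 1) / (c + 1) = (1 - 1 / c) / (1 - - 1 / c)); last first.
  by field; rewrite c_neq0 -[c + 1]/(c + 1) -[1]opprK sN1.
rewrite ln_div ?posrE//.
move: (ln _) (ln _) => L1 L2.
have q0 : c ^+ 2 - 1 != 0.
  rewrite (_ : _ - 1 = (c - 1) * (c - - 1)); last by ring.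
  by rewrite mulf_neq0.
rewrite opprK in sN1 *; field.
by rewrite q0 s1 sN1.
Qed.

End landau_flux.

Arguments aval : simpl never.

(** * The two integral identities for a test function *)

Section momentum.
Context {R : realType}.
Notation mu := (@lebesgue_measure R).
Notation R3 := (measurableTypeR R * measurableTypeR R * measurableTypeR R)%type.
Implicit Types (f g : R * R * R -> R) (x : R * R * R) (i j k : 'I_3) (s : aexp R).

(** Disposes of the junk values of the Landau fields and of their derivatives at the origin. *)
Lemma has_integral_eq_off0 f g (v : R) : has_integral (@lebesgue3 R) f v ->
  (forall x, x != 0 -> g x = f x) -> has_integral (@lebesgue3 R) g v.
Proof.
move=> [fi fv] gf.
have mf : measurable_fun [set: R3] f by apply/measurable_EFinP; exact: measurable_int fi.
have mg : measurable_fun [set: R3] g.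
  rewrite (_ : g = fun x => if 0 < enorm x then f x else g 0).
    apply: measurable_fun_ifT => //; apply: measurable_fun_ltr => //.
    exact: measurable_enorm.
  apply/funext => x; rewrite enorm_gt0; have [->|x0]//= := eqVneq x 0.
  exact: gf.
have ae : ae_eq (@lebesgue3 R) setT (EFin \o f) (EFin \o g).
  (* A whole null plane through the origin is discarded, being a measurable rectangle. *)
  exists (setT `*` [set 0]); split.
  - by apply: measurableX => //; exact: measurable_set1.
  - transitivity ((mu \x mu) setT * mu [set 0%R])%E; first exact: product_measure1E.
    by rewrite lebesgue_measure_set1 mule0.
  - move=> [p z] /= hN; split => //; apply: contrapT => /eqP z0; apply: hN => _.
    by rewrite /= gf//; apply: contra z0 => /eqP[_ ->].
split; last by rewrite -fv; apply/esym/ae_eq_integral => //; exact/measurable_EFinP.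
apply/integrableP; split; first exact/measurable_EFinP.
have /integrableP[_] := fi; apply: le_lt_trans.
rewrite le_eqVlt; apply/orP; left; apply/eqP/ae_eq_integral => //.
- by apply: measurableT_comp => //; exact/measurable_EFinP.
- by apply: measurableT_comp => //; exact/measurable_EFinP.
- by apply: ae_eq_abse; exact: ae_eq_sym.
Qed.

Variables (c M : R) (phi : R * R * R -> R).
Hypotheses (c1 : 1 < `|c|) (M0 : 0 < M) (sphi : smooth phi)
  (phiM : forall l : seq 'I_3, vanish_outside M (iter_partial l phi)).

Lemma test_C1_in_ball (l : seq 'I_3) : C1_in_ball M (iter_partial l phi).
Proof.
split; first exact: smooth_C1.
- exact: phiM.
- by move=> k; exact: (phiM (k :: l)).
Qed.

(** Two integrations by parts, against the j-th and the i-th derivative of [phi]; the second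
    derivatives cancel by [schwarz]. *)
Lemma has_integral_curl s i j : has_integral (@lebesgue3 R)
  (fun x => (enorm x ^+ 2)^-1 * (aval c (agrad i s) x * partial j phi x
     - aval c (agrad j s) x * partial i phi x)) 0.
Proof.
have := has_integralD (integration_by_parts3 c1 M0 s i (test_C1_in_ball [:: j]))
  (has_integralZ (-1) (integration_by_parts3 c1 M0 s j (test_C1_in_ball [:: i]))).
rewrite mulr0 addr0; apply: has_integral_eq => x /=.
rewrite (schwarz x i j sphi).
move: (partial j phi x) (partial i phi x) (partial j (partial i phi) x) => ? ? ?.
move: (aval c (agrad i s) x) (aval c (agrad j s) x) (aval c s x) => ? ? ?.
by move: (enorm x)^-1 (enorm x ^+ 2)^-1 => *; ring.
Qed.

Lemma div_landau :
  has_integral (@lebesgue3 R) (field_dot_grad (landau_u c) phi) 0.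
Proof.
have I j := integration_by_parts3 c1 M0 (angular_u c j) j (test_C1_in_ball [::]).
have := has_integralD (has_integralD (I 0) (I 1)) (I 2).
rewrite !addr0; move/has_integral_eq_off0; apply => x x0.
have := div_angular_u c1 x0; rewrite /field_dot_grad sum3 !landau_uE//=.
move: (partial 0 phi x) (partial 1 phi x) (partial 2 phi x) (phi x) => p0 p1 p2 p.
move: (aval c (agrad 0 _) x) (aval c (agrad 1 _) x) (aval c (agrad 2 _) x) => d0 d1 d2.
move: (aval c _ x) (aval c _ x) (aval c _ x) ((enorm x)^-1) ((enorm x ^+ 2)^-1).
move=> u0 u1 u2 r1 r2 d.
have -> : d2 = 0 - d0 - d1 by rewrite -d; ring.
ring.
Qed.

Lemma momentum_landau k (kappa : R) :
  (forall w : R, has_integral mu (fun a : R =>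
    (aval c (radial_part c k) ((a, 1), w) + aval c (radial_part c k) (- ((a, 1), w))) /
     enorm ((a, 1), w) ^+ 3) (kappa / (1 + w ^+ 2))) ->
  has_integral (@lebesgue3 R) (fun x => grad_dot (landau_u c k) phi x
    - landau_u c k x * field_dot_grad (landau_u c) phi x
    - landau_p c x * partial k phi x) (- phi 0 * (kappa * pi)).
Proof.
move=> hk.
have H0 := radial_flux c1 M0 (test_C1_in_ball [::]) hk.
have H1 := has_integral_curl (potential k 0) 2 1.
have H2 := has_integral_curl (potential k 1) 0 2.
have H3 := has_integral_curl (potential k 2) 1 0.
have := has_integralD (has_integralD (has_integralD H0 H1) H2) H3.
rewrite !addr0; move/has_integral_eq_off0; apply => x x0.
(* Indicators put the pressure term in the form used by [momentum_flux], uniformly in k. *)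
have pk : partial k phi x = (k == 0)%:R * partial 0 phi x +
    (k == 1)%:R * partial 1 phi x + (k == 2)%:R * partial 2 phi x.
  have gen (p : 'I_3 -> R) : p k = (k == 0)%:R * p 0 + (k == 1)%:R * p 1 + (k == 2)%:R * p 2.
    by elim/ord3_ind: k {hk H0 H1 H2 H3} => /=; ring.
  exact: (gen (fun k => partial k phi x)).
have := momentum_flux c1 k (partial 0 phi x) (partial 1 phi x) (partial 2 phi x) x0.
rewrite /grad_dot /field_dot_grad !sum3 pk landau_pE// !partial_landau_u// !landau_uE//=.
(* Restores the degree -2 that was stripped from the angular identity. *)
rewrite sum3 => /(congr1 ( *%R (enorm x ^+ 2)^-1)).
have n0 : enorm x != 0 by rewrite gt_eqF// enorm_gt0.
move: (partial 0 phi x) (partial 1 phi x) (partial 2 phi x) => p0 p1 p2.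
move: (dir 0 x) (dir 1 x) (dir 2 x) (aval c (radial_part c k) x) => t a b g.
move: (aval c (angular_p c) x) (k == 0)%:R (k == 1)%:R (k == 2)%:R => P e0 e1 e2.
move: (aval c (agrad 0 (angular_u c k)) x) (aval c (agrad 1 (angular_u c k)) x)
  (aval c (agrad 2 (angular_u c k)) x) => d0 d1 d2.
move: (aval c (agrad 2 (potential k 0)) x) (aval c (agrad 1 (potential k 0)) x)
  (aval c (agrad 0 (potential k 1)) x) (aval c (agrad 2 (potential k 1)) x)
  (aval c (agrad 1 (potential k 2)) x) (aval c (agrad 0 (potential k 2)) x)
  => a1 a2 a3 a4 a5 a6.
move: (aval c (angular_u c k) x) (aval c (angular_u c 0) x) (aval c (angular_u c 1) x)
  (aval c (angular_u c 2) x) (enorm x) n0 => uk u0 u1 u2 n n0 e.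
by refine (etrans _ (etrans e _)); field.
Qed.

End momentum.

(** * The strength of the point force *)

Section landau_b.
Context {R : realType}.
Implicit Types (c s t : R).

(** The series is -2 (s + s^3/3 + s^5/5 + ...), and its tail is at most (2/3) s^3 (1 + s^2 + ...).
    The proof compares derivatives instead: with the correction [k] the derivative is (4/3) u^4 / (1
    - u^2)^2. *)
Lemma ln_ratio_bounds s : 0 < s -> s < 1 ->
  - (2 * s) - 2 / 3 * s ^+ 3 / (1 - s ^+ 2) <= ln ((1 - s) / (1 + s)) < - (2 * s).
Proof.
move=> s0 s1.
have range (t : R) : 0 <= t -> t <= s -> (0 < 1 - t) * (0 < 1 + t) * (0 < 1 - t ^+ 2).
  move=> t0 ts; have t1 : 0 < 1 - t by lra.
  have t2 : 0 < 1 + t by lra.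
  by rewrite t1 t2 (_ : 1 - t ^+ 2 = (1 - t) * (1 + t)) ?mulr_gt0//; ring.
pose g (t : R) := ln (1 - t) - ln (1 + t) + 2 * t.
pose k (t : R) := 2 / 3 * (t ^+ 3 * (1 - t ^+ 2)^-1).
have dln (t : R) : 0 <= t -> t <= s -> is_derive t 1 g (- (2 * t ^+ 2) / (1 - t ^+ 2)).
  move=> t0 ts; have [[t1 t2] t3] := range t t0 ts.
  have d1 := @is_derive1_comp R (@ln R) (fun t => 1 - t) t _ _ (is_derive1_ln t1)
    (is_deriveB (is_derive_cst (1 : R) t 1) (is_derive_id t 1)).
  have d2 := @is_derive1_comp R (@ln R) (fun t => 1 + t) t _ _ (is_derive1_ln t2)
    (is_deriveD (is_derive_cst (1 : R) t 1) (is_derive_id t 1)).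
  apply: is_derive_eq; rewrite /GRing.scale/=; field.
  by rewrite !gt_eqF.
have dk (t : R) : 0 <= t -> t <= s -> is_derive t 1 k
    (2 / 3 * ((3 * t ^+ 2 - t ^+ 4) / (1 - t ^+ 2) ^+ 2)).
  move=> t0 ts; have [_ t3] := range t t0 ts.
  have dv := @is_deriveV R (fun t => 1 - t ^+ 2) t _ 1 (lt0r_neq0 t3)
    (is_deriveB (is_derive_cst (1 : R) t 1) (is_deriveX 2 (is_derive_id t 1))).
  apply: is_derive_eq; rewrite /GRing.scale/=; field.
  by rewrite !gt_eqF.
have g0 : g 0 = 0 by rewrite /g subr0 addr0 ln1 mulr0 subrr addr0.
have k0 : k 0 = 0 by rewrite /k expr0n mul0r mulr0.
have [[s1' s2'] s3'] := range s (ltW s0) (lexx s).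
have gs : g s = ln ((1 - s) / (1 + s)) + 2 * s by rewrite ln_div ?posrE.
apply/andP; split.
  have [||u] := @MVT_segment R (fun t => g t + k t)
    (fun t => - (2 * t ^+ 2) / (1 - t ^+ 2) + 2 / 3 * ((3 * t ^+ 2 - t ^+ 4) / (1 - t ^+ 2) ^+ 2))
    0 s (ltW s0).
  - move=> t; rewrite in_itv/= => /andP[t0 ts].
    by apply: is_deriveD; [apply: dln|apply: dk]; exact: ltW.
  - apply: continuous_in_subspaceT => t; rewrite inE/= in_itv/= => /andP[t0 ts].
    by apply: cvgD; [exact: (is_derive_continuous (dln t t0 ts))|
      exact: (is_derive_continuous (dk t t0 ts))].
  rewrite in_itv/= => /andP[u0 us].
  rewrite g0 k0 gs subr0 add0r subr0 => e.
  have [_ u3] := range u u0 us.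
  suff : 0 <= ln ((1 - s) / (1 + s)) + 2 * s + k s by rewrite /k; lra.
  rewrite e mulr_ge0 ?(ltW s0)//.
  rewrite (_ : _ + _ = 4 / 3 * u ^+ 4 / (1 - u ^+ 2) ^+ 2); last first.
    by field; rewrite gt_eqF.
  apply: divr_ge0; last by rewrite exprn_ge0// ltW.
  by apply: mulr_ge0; [lra|rewrite exprn_ge0// ltW].
(* The strict bound needs an interior point t > 0, where the derivative is negative. *)
have [||t] := @MVT R g (fun t => - (2 * t ^+ 2) / (1 - t ^+ 2)) 0 s s0.
- by move=> t; rewrite in_itv/= => /andP[t0 ts]; apply: dln; exact: ltW.
- apply: continuous_in_subspaceT => t; rewrite inE/= in_itv/= => /andP[t0 ts].
  exact: (is_derive_continuous (dln t t0 ts)).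
rewrite in_itv/= => /andP[t0 ts]; rewrite g0 gs !subr0 => e.
have [_ t3] := range t (ltW t0) (ltW ts).
suff : ln ((1 - s) / (1 + s)) + 2 * s < 0 by lra.
rewrite e mulNr mulNr oppr_lt0 !mulr_gt0 ?invr_gt0 ?exprn_gt0//.
Qed.

Lemma ln_landau_bounds c : 1 < c ->
  - (2 / c) - 2 / 3 / (c * (c ^+ 2 - 1)) <= ln ((c - 1) / (c + 1)) < - (2 / c).
Proof.
move=> c1; have c0 : 0 < c by lra.
have := @ln_ratio_bounds c^-1.
rewrite invr_gt0 c0 invf_lt1// c1 => /(_ isT isT).
have cp : c + 1 != 0 by rewrite gt_eqF//; lra.
have cm : c - 1 != 0 by rewrite gt_eqF//; lra.
have cn : c != 0 by rewrite gt_eqF.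
have q0 : c ^+ 2 - 1 != 0 by rewrite (_ : _ - 1 = (c - 1) * (c + 1)) ?mulf_neq0//; ring.
rewrite (_ : (1 - c^-1) / (1 + c^-1) = (c - 1) / (c + 1)); last by field; rewrite cn cp.
rewrite (_ : 2 / 3 * c^-1 ^+ 3 / (1 - c^-1 ^+ 2) = 2 / 3 / (c * (c ^+ 2 - 1)))//.
by field; rewrite cn q0.
Qed.

(** Changing the sign of c inverts the ratio (c - 1)/(c + 1), hence changes the sign of its
    logarithm. *)
Lemma landau_bN c : 1 < `|c| -> landau_b (- c) = - landau_b c.
Proof.
move=> c1; have r0 : 0 < (c - 1) / (c + 1).
  move: c1; rewrite ltr_normr => /orP[c1|c1].
    by rewrite divr_gt0//; lra.
  by rewrite -[_ / _]mulrNN -invrN divr_gt0//; lra.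
have cp : c + 1 != 0 by apply: contraTneq r0 => ->; rewrite invr0 mulr0 ltxx.
have cm : c - 1 != 0 by apply: contraTneq r0 => ->; rewrite mul0r ltxx.
rewrite /landau_b (_ : (- c - 1) / (- c + 1) = ((c - 1) / (c + 1))^-1); last first.
  by field; rewrite cp cm /= -[- c + 1]opprK oppr_eq0 opprD opprK.
rewrite lnV ?posrE// sqrrN mulNr; ring.
Qed.

(** With X = c/(c^2 - 1), the logarithm bounds place 4 c + 2 c^2 ln between - (4/3) X and 0, to
    which (16/3) X is added. *)
Lemma landau_b_bounds c : 1 < c ->
  4 * pi * (4 * (c / (c ^+ 2 - 1))) <= landau_b c <= 4 * pi * (16 / 3 * (c / (c ^+ 2 - 1))).
Proof.
move=> c1; have c0 : 0 < c by lra.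
have q0 : 0 < c ^+ 2 - 1.
  by rewrite (_ : _ - 1 = (c - 1) * (c + 1)) ?mulr_gt0//; [lra|lra|ring].
have /andP[l1 l2] := ln_landau_bounds c1.
have c2 : 0 < 2 * c ^+ 2 by rewrite mulr_gt0 ?exprn_gt0.
move: l1 l2; rewrite -(ler_pM2l c2) -(ltr_pM2l c2).
rewrite (_ : 2 * c ^+ 2 * (- (2 / c) - _) = - (4 * c) - 4 / 3 * (c / (c ^+ 2 - 1))); last first.
  by field; rewrite !gt_eqF.
rewrite (_ : 2 * c ^+ 2 * - (2 / c) = - (4 * c)); last by field; rewrite gt_eqF.
rewrite /landau_b => l1 l2.
have p0 : 0 < 4 * pi :> R by rewrite mulr_gt0 ?pi_gt0.
by rewrite !ler_pM2l//; apply/andP; split; lra.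
Qed.

(** In the derivative [db], ln < - 2/c bounds the logarithmic term by - 8, which cancels the
    constants 4 + 4; the remaining rational function is negative. *)
Lemma landau_b_decreasing c1 c2 : 1 < c1 -> c1 < c2 -> landau_b c2 < landau_b c1.
Proof.
move=> h1 h12.
pose db c := 4 * pi * (4 + 4 * c * ln ((c - 1) / (c + 1)) + 4 * c ^+ 2 / (c ^+ 2 - 1)
  - 16 / 3 * ((c ^+ 2 + 1) / (c ^+ 2 - 1) ^+ 2)).
have pos c : 1 < c -> (0 < c - 1) * (0 < c + 1) * (0 < c ^+ 2 - 1).
  move=> c1'; have a1 : 0 < c - 1 by lra.
  have a2 : 0 < c + 1 by lra.
  by rewrite a1 a2 (_ : _ ^+ 2 - 1 = (c - 1) * (c + 1)) ?mulr_gt0//; ring.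
have d c : 1 < c -> is_derive c 1 (@landau_b R) (db c).
  move=> /pos[[a1 a2] a3].
  have n2 := lt0r_neq0 a2; have n3 := lt0r_neq0 a3.
  have r0 : 0 < (c - 1) / (c + 1) by rewrite divr_gt0.
  have dr : is_derive c 1 (fun c : R => (c - 1) / (c + 1)) (2 / (c + 1) ^+ 2).
    have dv := @is_deriveV R (fun c => c + 1) c _ 1 n2
      (is_deriveD (is_derive_id c 1) (is_derive_cst (1 : R) c 1)).
    by apply: is_derive_eq; rewrite /GRing.scale/=; field.
  have dl := @is_derive1_comp R (@ln R) _ c _ _ (is_derive1_ln r0) dr.
  have dq := @is_deriveV R (fun c => c ^+ 2 - 1) c _ 1 n3
    (is_deriveB (is_deriveX 2 (is_derive_id c 1)) (is_derive_cst (1 : R) c 1)).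
  apply: is_derive_eq; rewrite /db /GRing.scale/=.
  move: (ln _) => L; field.
  by rewrite n3 n2 gt_eqF.
have [||u] := @MVT R (@landau_b R) db c1 c2 h12.
- by move=> c; rewrite in_itv/= => /andP[c1c _]; apply: d; lra.
- apply: continuous_in_subspaceT => c; rewrite inE/= in_itv/= => /andP[c1c _].
  by apply: (is_derive_continuous (d c _)); lra.
rewrite in_itv/= => /andP[u1 _] e.
rewrite -subr_lt0 e pmulr_llt0 ?subr_gt0//.
have u_1 : 1 < u by lra.
have [[a1 a2] a3] := pos u u_1.
have u4 : 0 < 4 * u by lra.
have /andP[_ l0] := ln_landau_bounds u_1.
have l : 4 * u * ln ((u - 1) / (u + 1)) < - 8.
  rewrite (_ : - 8 = 4 * u * - (2 / u)) ?ltr_pM2l//.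
  by field; rewrite gt_eqF//; lra.
rewrite /db pmulr_rlt0 ?mulr_gt0 ?pi_gt0//.
have -> : 4 * u ^+ 2 / (u ^+ 2 - 1) = 4 + 4 / (u ^+ 2 - 1) by field; rewrite gt_eqF.
suff : 4 / (u ^+ 2 - 1) < 16 / 3 * ((u ^+ 2 + 1) / (u ^+ 2 - 1) ^+ 2) by lra.
rewrite -subr_gt0.
rewrite (_ : _ - _ = (4 / 3 * u ^+ 2 + 28 / 3) / (u ^+ 2 - 1) ^+ 2); last first.
  by field; rewrite gt_eqF.
by rewrite divr_gt0 ?exprn_gt0// ltr_wpDl// mulr_ge0// sqr_ge0.
Qed.

(** An explicit rate of blow-up at 1, which by oddness serves both one-sided limits. *)
Lemma landau_b_ge c : 1 < c -> c < 2 -> (c - 1)^-1 <= landau_b c.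
Proof.
move=> h1 h2; have /andP[h _] := landau_b_bounds h1; apply: le_trans h.
have a1 : 0 < c - 1 by lra.
have a2 : 0 < c + 1 by lra.
have p2 : 2 <= pi :> R by exact: pi_ge2.
rewrite (_ : 4 * pi * _ = pi * (16 * c / (c + 1)) * (c - 1)^-1); last first.
  by rewrite (_ : c ^+ 2 - 1 = (c - 1) * (c + 1)); [field; rewrite !gt_eqF|ring].
rewrite ler_peMl ?invr_ge0 ?(ltW a1)//.
have h3 : 1 <= 16 * c / (c + 1) by rewrite ler_pdivlMr//; lra.
have h4 : 2 * 1 <= pi * (16 * c / (c + 1)) by apply: ler_pM.
by apply: le_trans h4; lra.
Qed.

Lemma landau_b_right : landau_b c @[c --> (1 : R)^'+] --> +oo.
Proof.
apply/cvgryPge => A; near=> c.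
have h1 : 1 < c by [].
have h2 : c < 2 by near: c; apply: nbhs_right_lt; lra.
apply: le_trans (landau_b_ge h1 h2).
have A0 : 0 < `|A| + 1 by rewrite ltr_wpDl.
have h3 : c < 1 + (`|A| + 1)^-1 by near: c; apply: nbhs_right_lt; rewrite ltrDl invr_gt0.
rewrite (le_trans (ler_norm A))// (@le_trans _ _ (`|A| + 1))// ?lerDl//.
by rewrite -[leLHS]invrK lef_pV2 ?posrE ?invr_gt0//; lra.
Unshelve. all: by end_near. Qed.

Lemma landau_b_left : landau_b c @[c --> (-1 : R)^'-] --> -oo.
Proof.
apply/cvgrNyPle => A; near=> c.
have h1 : 1 < - c by rewrite ltrNr.
have h2 : - c < 2 by rewrite ltrNl; near: c; apply: nbhs_left_gt; lra.
have c1 : 1 < `|- c| by rewrite (lt_le_trans h1)// ler_norm.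
rewrite -[c]opprK landau_bN// lerNl; apply: le_trans (landau_b_ge h1 h2).
have A0 : 0 < `|A| + 1 by rewrite ltr_wpDl.
have h3 : - c < 1 + (`|A| + 1)^-1.
  rewrite ltrNl; near: c; apply: nbhs_left_gt.
  by rewrite opprD ltrBlDr ltrDl invr_gt0.
rewrite (le_trans (ler_norm (- A)))// normrN (@le_trans _ _ (`|A| + 1))// ?lerDl//.
by rewrite -[leLHS]invrK lef_pV2 ?posrE ?invr_gt0//; lra.
Unshelve. all: by end_near. Qed.

Lemma landau_b_infty : landau_b c @[c --> @abs_pinfty R] --> (0 : R).
Proof.
apply/cvgrPdist_le => e e0.
have K0 : 0 < 4 * pi * (32 / 3) :> R by rewrite !mulr_gt0 ?pi_gt0//; lra.
(* The summand 2 ensures c/(c^2 - 1) <= 2/c, hence b <= 4 pi (32/3)/c; the other summand makes this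
   at most e. *)
pose M : R := 2 + 4 * pi * (32 / 3) / e.
have bound c : M < c -> `|landau_b c| <= e.
  move=> Mc.
  have Ke : 0 < 4 * pi * (32 / 3) / e :> R by rewrite divr_gt0.
  have c2 : 2 < c by move: Mc; rewrite /M; lra.
  have c1 : 1 < c by lra.
  have q0 : 0 < c ^+ 2 - 1 by nra.
  have /andP[l1 l2] := landau_b_bounds c1.
  have f0 : 0 <= c / (c ^+ 2 - 1) by rewrite divr_ge0 ?ltW//; lra.
  rewrite ger0_norm; last first.
    by apply: le_trans l1; apply: mulr_ge0; [rewrite mulr_ge0 ?pi_ge0|exact: mulr_ge0].
  apply: (le_trans l2).
  have f1 : c / (c ^+ 2 - 1) <= 2 / c.
    by rewrite ler_pdivrMr// mulrAC ler_pdivlMr; [nra|lra].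
  apply: (@le_trans _ _ (4 * pi * (32 / 3) / c)).
    rewrite -[leRHS]mulrA ler_pM2l ?mulr_gt0 ?pi_gt0//; lra.
  rewrite ler_pdivrMr; last by lra.
  rewrite -ler_pdivrMl// mulrC.
  by move: Mc; rewrite /M; lra.
exists M => // c /= Mc; rewrite sub0r normrN.
have [c0|c0] := leP 0 c; first by apply: bound; rewrite -(ger0_norm c0).
have cc : 1 < `|- c|.
  rewrite normrN (le_lt_trans _ Mc)// /M.
  have : 0 < 4 * pi * (32 / 3) / e :> R by rewrite divr_gt0.
  by lra.
by rewrite -[c]opprK landau_bN// normrN; apply: bound; rewrite -(ltr0_norm c0).
Qed.

End landau_b.

(** * The integral identities and the behaviour of b together *)

Theorem proposition2p1 (R : realType) :
  (forall c : R, 1 < `|c| ->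
   forall phi : R * R * R -> R, test_function phi ->
     let u := landau_u c in
     let p := landau_p c in
     let div_term := fun x => field_dot_grad u phi x in
     let mom_term := fun (k : 'I_3) x =>
       grad_dot (u k) phi x - u k x * field_dot_grad u phi x
       - p x * partial k phi x in
     ((@lebesgue3 R).-integrable [set: R * R * R] (EFin \o div_term) /\
      \int[@lebesgue3 R]_x div_term x = 0) /\
     (forall k : 'I_3,
        (@lebesgue3 R).-integrable [set: R * R * R] (EFin \o mom_term k) /\
        \int[@lebesgue3 R]_x mom_term k x =
          if k == 0%N :> nat then landau_b c * phi (0, 0, 0) else 0)) /\
  ({in `]-oo, -1[ &, forall c1 c2 : R, c1 < c2 -> landau_b c2 < landau_b c1} /\
   {in `]1, +oo[ &, forall c1 c2 : R, c1 < c2 -> landau_b c2 < landau_b c1}) /\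
  [/\ landau_b c @[c --> (1 : R)^'+] --> +oo,
      landau_b c @[c --> (-1 : R)^'-] --> -oo &
      landau_b c @[c --> @abs_pinfty R] --> (0 : R)].
Proof.
split; [|split; [split|split]].
- move=> c c1 phi [sphi cphi] u p div_term mom_term.
  have [M M0 phiM] := test_function_vanish (conj sphi cphi).
  have value (f : R * R * R -> R) (v : R) : has_integral (@lebesgue3 R) f v ->
      (@lebesgue3 R).-integrable [set: R * R * R] (EFin \o f) /\
      \int[@lebesgue3 R]_x f x = v.
    by move=> [fi fv]; split => //; rewrite /Rintegral fv.
  split; first exact: (value _ _ (div_landau c1 M0 sphi phiM)).
  move=> k; apply: value; case: ifPn => k0.
    have -> : k = 0 by apply/val_inj/eqP.
    (* The flux is - b(c) and the radial integral carries - phi(0), so the signs multiply to + b(c)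
       phi(0). *)
    have -> : landau_b c * phi (0, 0, 0) = - phi 0 *
        (2 * (radial1_primitive c 1 - radial1_primitive c (- 1)) * pi).
      by rewrite radial1_primitive_landau_b// mulrNN mulrC.
    exact: (momentum_landau c1 M0 sphi phiM (radial1_flux c1)).
  have kn0 : k != 0 by apply: contraNneq k0 => ->.
  (* The value 0 takes the shape of a radial flux with [kappa] equal to 0. *)
  rewrite -(mulr0 (- phi 0)) -[X in - phi 0 * X](mul0r pi).
  apply: (momentum_landau c1 M0 sphi phiM) => w.
  by rewrite mul0r; exact: radial23_flux.
- move=> c1 c2; rewrite !in_itv/= => h1 h2 h12.
  have n1 : 1 < `|c1| by rewrite ltr_normr ltrNr h1 orbT.
  have n2 : 1 < `|c2| by rewrite ltr_normr ltrNr h2 orbT.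
  rewrite -ltrN2 -!landau_bN//; apply: landau_b_decreasing; first by rewrite ltrNr.
  by rewrite ltrN2.
- move=> c1 c2; rewrite !in_itv/= !andbT => h1 _; exact: landau_b_decreasing.
- exact: landau_b_right.
- exact: landau_b_left.
- exact: landau_b_infty.
Qed.
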